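(* For every $c\in(0,\infty)$ the set $PAM(\lambda)_{entr=c}$ of all maps $f\in PAM(\lambda)$ with metric entropy $h_\lambda(f)=c$ is dense in the metric space $(C(\lambda),\rho)$.
   Context: $\lambda$ is the Lebesgue measure on $[0,1]$, $\mathcal B$ the Borel $\sigma$-algebra of $[0,1]$. $C(\lambda)$ is the set of all continuous maps $f\colon[0,1]\to[0,1]$ with $\lambda(A)=\lambda(f^{-1}(A))$ for all $A\in\mathcal B$, equipped with the complete metric $\rho(f,g)=\sup_{x\in[0,1]}|f(x)-g(x)|$. $PA(\lambda)$ is the set of all piecewise affine maps (finitely many affine pieces) in $C(\lambda)$. $PAM(\lambda)$ is the set of all piecewise affine Markov maps in $PA(\lambda)$, i.e. those maps for which all points of discontinuity of the derivative and also both endpoints $0,1$ are eventually periodic. $h_\lambda(f)$ denotes the measure-theoretic (Kolmogorov–Sinai) entropy of $f$ with respect to $\lambda$. *)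

(* Defs.v *)
From HB Require Import structures.
From mathcomp Require Import all_boot all_order all_algebra.
From mathcomp Require Import all_classical all_reals all_analysis.
Import Order.TTheory GRing.Theory Num.Theory.
Import numFieldNormedType.Exports.

Set Implicit Arguments.
Unset Strict Implicit.
Unset Printing Implicit Defensive.

Local Open Scope classical_set_scope.
Local Open Scope ring_scope.

(* Self-maps of [0, 1] are represented by functions R -> R; every notion below
   depends only on the values taken on [0, 1]. *)

(* General notions for a self-map f of a measurable subset D of T. *)
Section MeasurePreservation.
Context d (T : measurableType d) (R : realType).
Variables (mu : set T -> \bar R) (D : set T).

Definition measure_preserving_on (f : T -> T) : Prop :=
  forall A : set T, measurable A -> A `<=` D ->
    measurable (D `&` f @^-1` A) /\ mu (D `&` f @^-1` A) = mu A.

Definition measurable_partition (m : nat) (P : 'I_m -> set T) : Prop :=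
  (forall i, measurable (P i)) /\ partition [set: 'I_m] P D.

(* The convention 0 * ln 0 = 0 holds since ln vanishes at 0. *)
Definition partition_entropy (I : finType) (P : I -> set T) : R :=
  - \sum_(i : I) fine (mu (P i)) * ln (fine (mu (P i))).

(* The cells of the join of P, f^-1 P, ..., f^-(n-1) P, indexed by itineraries
   of length n (some of the cells may be empty). *)
Definition itinerary_cell (f : T -> T) (m : nat) (P : 'I_m -> set T) (n : nat)
    (w : {ffun 'I_n -> 'I_m}) : set T :=
  [set x | D x /\ forall k : 'I_n, P (w k) (iter k f x)].

Definition entropy_wrt (f : T -> T) (m : nat) (P : 'I_m -> set T) : R :=
  limn (fun n : nat =>
    n%:R^-1 * partition_entropy (itinerary_cell f P (n := n))).

Definition KS_entropy (f : T -> T) : \bar R :=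
  ereal_sup [set h | exists (m : nat) (P : 'I_m -> set T),
    measurable_partition P /\ h = (entropy_wrt f P)%:E].

End MeasurePreservation.

Section IntervalMaps.
Variable R : realType.
Implicit Types f g : R -> R.

Definition unit_itv : set R := `[0, 1]%classic.

Definition C_lambda : set (R -> R) :=
  [set f | [/\ set_fun unit_itv unit_itv f,
               {within unit_itv, continuous f} &
               measure_preserving_on (@lebesgue_measure R) unit_itv f]].

Definition rho f g : R := sup [set `|f x - g x| | x in unit_itv].

Definition affine_on (A : set R) f : Prop :=
  exists a b : R, forall x, A x -> f x = a * x + b.

(* A partition 0 = t_0 < t_1 < ... < t_n = 1 is given by s = [:: t_1; ...; t_n]. *)
Definition piecewise_affine f : Prop :=
  exists2 s : seq R, itv_partition 0 1 s &
    forall i, (i < size s)%N ->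
      affine_on `[nth 0 (0 :: s) i, nth 0 s i]%classic f.

Definition PA_lambda : set (R -> R) := C_lambda `&` piecewise_affine.

Definition eventually_periodic f (x : R) : Prop :=
  exists k p : nat, (0 < p)%N /\ iter (k + p) f x = iter k f x.

(* Interior points only; points where the derivative does not exist count as
   discontinuities. *)
Definition derivative_discontinuity f (x : R) : Prop :=
  0 < x < 1 /\ ~ (derivable f x 1 /\ {for x, continuous (derive1 f)}).

Definition PAM_lambda : set (R -> R) :=
  PA_lambda `&`
  [set f | [/\ forall x, derivative_discontinuity f x -> eventually_periodic f x,
               eventually_periodic f 0 & eventually_periodic f 1]].

Definition lambda_entropy f : \bar R :=
  KS_entropy (@lebesgue_measure R) unit_itv f.

Definition PAM_lambda_entr (c : R) : set (R -> R) :=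
  PAM_lambda `&` [set f | lambda_entropy f = c%:E].

Definition dense_in (T : Type) (dist : T -> T -> R) (X S : set T) : Prop :=
  S `<=` X /\
  forall x, X x -> forall e : R, 0 < e -> exists2 y, S y & dist x y < e.

End IntervalMaps.

(* Main.v *)
From HB Require Import structures.
Require Import Defs.
From mathcomp Require Import all_boot all_order all_algebra.
From mathcomp Require Import all_classical all_reals all_analysis.
From mathcomp Require Import measurable_realfun.
From mathcomp Require Import ring lra zify.
Import Order.TTheory GRing.Theory Num.Theory.
Import numFieldNormedType.Exports.

Set Implicit Arguments.
Unset Strict Implicit.
Unset Printing Implicit Defensive.

Local Open Scope classical_set_scope.
Local Open Scope ring_scope.

(** Why the theorem holds.

    Cut [0, 1] into [N] cells of equal length, with [N] large.  The maps that
    approximate a given [f] are Markov zigzag maps: [0, 1] is divided into finitely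
    many laps, each contained in one cell, and each lap is mapped affinely onto a
    whole cell, consecutive laps fitting together continuously.  The end points of
    the laps are sent to the grid [{k/N}], which the map leaves invariant, so they
    are eventually periodic.  A zigzag map preserves Lebesgue measure as soon as, for
    each cell, the laps that cover it have total length [1/N].  For a lap of length
    [l], the factor [N l] is the inverse of the slope.

    Entropy of a zigzag map.  The successive lap numbers of a point form a Markov
    chain: a cylinder of positive measure has measure the product of the factors
    [N l] of its laps divided by [N].  With the number of symbols of the itinerary
    growing, the entropy of the lap partition therefore grows at the rate
    [h = - sum l ln (N l)].  Since every slope is larger than 1, cylinders shrink
    to points, and by inner regularity of Lebesgue measure every finite partition is
    a function of a long enough lap itinerary up to a set of small measure.  Gibbs'
    inequality then bounds the entropy rate of every partition by [h] plus an
    arbitrarily small amount: the label of a point is guessed from its lap itinerary,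
    and wrong guesses cost little ([itinerary_entropy_le]).  Hence the entropy of the map
    is exactly [h] ([KS_entropy_code], [zigzag_entropy]).

    Approximation.  Let [pi] number the cells by increasing value of [f] at their
    left end points.  As [f] preserves Lebesgue measure, about a proportion [y] of
    the cells have a value below [y], so that [pi a / N] is close to [f (a / N)]
    ([rank_permutation]).  In cell [a] the zigzag map walks on the grid from a vertex
    near [pi a] to a vertex near [pi (a + 1)], covering every cell at distance at most
    [r] of [pi a] at least [C] times, and no other ([window_walk_exists]).  Such a map
    is close to [f] whatever the lengths of the laps, which remain to be chosen.

    Tuning.  Two choices of relative lap lengths in the cells satisfy the balance
    condition.  The first gives all the length of cell [a] to one lap covering cell
    [pi a]; this is balanced because [pi] is a permutation, and has entropy 0, but is
    degenerate.  The second distributes the length according to a symmetric doubly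
    stochastic band matrix, evenly among the laps covering the same cell; every
    relative length is positive and at most [1/C], so the entropy is at least [ln C].
    On the segment between them all lap lengths are positive away from the first end,
    the balance condition persists, and the entropy is continuous, with limit 0 at the
    first end.  If [ln C >= c] the value [c] is taken ([weight_entropy_value]). *)

(** * Laws and entropies of finitely valued functions *)

Lemma ln_le_sub1 (R : realType) (x : R) : 0 < x -> ln x <= x - 1.
Proof. by move=> x0; have := @le_ln1Dx R (x - 1); rewrite subrKC; apply; lra. Qed.

(** The convexity estimate [ln x <= x - 1], applied to the quotients [q i / p i]. *)
Lemma gibbs (R : realType) (I : finType) (p q : I -> R) :
  (forall i, 0 <= p i) -> (forall i, 0 <= q i) ->
  (forall i, 0 < p i -> 0 < q i) -> \sum_i q i <= \sum_i p i ->
  - (\sum_i p i * ln (p i)) <= - (\sum_i p i * ln (q i)).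
Proof.
move=> p0 q0 pq qp; rewrite lerN2 -subr_le0 -sumrB.
apply: (@le_trans _ _ (\sum_i (q i - p i))); last by rewrite sumrB subr_le0.
apply: ler_sum => i _; have := p0 i; rewrite le_eqVlt => /predU1P[<-|pi0].
  by rewrite !mul0r subrr subr0 q0.
have qi0 := pq i pi0; rewrite -mulrBr -ln_div//.
apply: (@le_trans _ _ (p i * (q i / p i - 1))).
  by rewrite ler_pM2l// ln_le_sub1// divr_gt0.
by rewrite mulrBr mulr1 mulrCA divff ?mulr1// gt_eqF.
Qed.

Lemma ln_prod (R : realType) (I : finType) (F : I -> R) :
  (forall i, 0 < F i) -> ln (\prod_i F i) = \sum_i ln (F i).
Proof.
move=> F0; apply: expR_inj; rewrite lnK ?posrE ?prodr_gt0// expR_sum.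
by apply: eq_bigr => i _; rewrite lnK ?posrE.
Qed.

Section FiniteRandomVariables.
Context d (T : measurableType d) (R : realType).
Variables (mu : {measure set T -> \bar R}) (D : set T).

(** A finite partition of [D] is handled through the function that sends a point to
    the index of its cell: joins become pairs, and refinements become factorizations. *)
Definition simple_on (I : Type) (X : T -> I) :=
  forall i, measurable (D `&` X @^-1` [set i]).

Definition law (I : Type) (X : T -> I) (i : I) : R :=
  fine (mu (D `&` X @^-1` [set i])).

Definition law_entropy (I : finType) (X : T -> I) : R :=
  - \sum_i law X i * ln (law X i).

Definition itinerary (I : finType) (f : T -> T) (X : T -> I) (n : nat) (x : T)
  : {ffun 'I_n -> I} := [ffun k : 'I_n => X (iter k f x)].

Hypotheses (mD : measurable D) (muD : mu D = 1%E).

Lemma law_ge0 (I : Type) (X : T -> I) i : 0 <= law X i.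
Proof. by rewrite /law fine_ge0. Qed.

Lemma lawE (I : Type) (X : T -> I) i : simple_on X ->
  (law X i)%:E = mu (D `&` X @^-1` [set i]).
Proof.
move=> sX; rewrite /law fineK// ge0_fin_numE//; apply: le_lt_trans (ltry 1).
by rewrite -muD; apply: le_measure; rewrite ?inE//; exact: subIsetl.
Qed.

Lemma simple_pred (I : finType) (X : T -> I) (A : {pred I}) : simple_on X ->
  measurable (D `&` [set x | X x \in A]) /\
  fine (mu (D `&` [set x | X x \in A])) = \sum_(i in A) law X i.
Proof.
move=> sX.
have -> : D `&` [set x | X x \in A] =
    \bigcup_(i in [set` enum A]) (D `&` X @^-1` [set i]).
  apply/seteqP; split=> [x [Dx Ax]|x [i /=]].
    by exists (X x) => //=; rewrite mem_enum.
  by rewrite mem_enum => Ai [Dx /= Xi]; split=> /=; rewrite ?Xi.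
have mF i : [set` enum A] i -> measurable (D `&` X @^-1` [set i]) by move=> _.
split; first exact: fin_bigcup_measurable.
rewrite measure_fin_bigcup//; last by move=> i j _ _ [x [[_ /= Xi] [_ Xj]]]; rewrite -Xi -Xj.
rewrite -fsbig_seq ?enum_uniq// big_enum/=.
by under eq_bigr do rewrite -lawE//; rewrite sumEFin.
Qed.

Lemma preimage_image (I J : finType) (X : T -> I) (Y : T -> J) (phi : I -> J) j :
  (forall x, D x -> Y x = phi (X x)) ->
  D `&` [set x | X x \in [pred i | phi i == j]] = D `&` Y @^-1` [set j].
Proof.
move=> YX; apply/seteqP; split=> x [Dx] /=; rewrite inE -YX//; first by move/eqP.
by move=> ->; split.
Qed.

Lemma simple_image (I J : finType) (X : T -> I) (Y : T -> J) (phi : I -> J) :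
  simple_on X -> (forall x, D x -> Y x = phi (X x)) -> simple_on Y.
Proof.
move=> sX YX j; have [+ _] := simple_pred [pred i | phi i == j] sX.
by rewrite (preimage_image j YX).
Qed.

Lemma law_image (I J : finType) (X : T -> I) (Y : T -> J) (phi : I -> J) j :
  simple_on X -> (forall x, D x -> Y x = phi (X x)) ->
  law Y j = \sum_(i | phi i == j) law X i.
Proof.
move=> sX YX; have [_ /=] := simple_pred [pred i | phi i == j] sX.
by rewrite (preimage_image j YX).
Qed.

Lemma sum_law_image (I J : finType) (X : T -> I) (Y : T -> J) (phi : I -> J)
    (F : J -> R) :
  simple_on X -> (forall x, D x -> Y x = phi (X x)) ->
  \sum_j law Y j * F j = \sum_i law X i * F (phi i).
Proof.
move=> sX YX; rewrite [RHS](partition_big phi predT)//=.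
apply: eq_bigr => j _; rewrite (law_image j sX YX) mulr_suml.
by apply: eq_bigr => i /eqP ->.
Qed.

Lemma sum_law (I : finType) (X : T -> I) : simple_on X -> \sum_i law X i = 1.
Proof.
move=> sX; have [_ /=] := simple_pred predT sX.
by rewrite (_ : D `&` _ = D) ?muD//; apply/seteqP; split=> x //= [].
Qed.

Lemma simple_pair (I J : finType) (X : T -> I) (Y : T -> J) :
  simple_on X -> simple_on Y -> simple_on (fun x => (X x, Y x)).
Proof.
move=> sX sY [i j]; rewrite (_ : _ `&` _ =
  (D `&` X @^-1` [set i]) `&` (D `&` Y @^-1` [set j])).
  exact: measurableI.
by apply/seteqP; split=> [x [Dx [<- <-]]//|x [[Dx <-] [_ <-]]].
Qed.

Section Preserved.
Variable f : T -> T.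
Hypotheses (fD : set_fun D D f) (mpf : measure_preserving_on mu D f).

Lemma iter_stable k x : D x -> D (iter k f x).
Proof. by move=> Dx; elim: k => //= k; exact: fD. Qed.

Lemma simple_law_iter (I : Type) (X : T -> I) k : simple_on X ->
  simple_on (X \o iter k f) /\ law (X \o iter k f) = law X.
Proof.
move=> sX; elim: k => [//|k [sk lk]].
have E i : D `&` (X \o iter k.+1 f) @^-1` [set i] =
    D `&` f @^-1` (D `&` (X \o iter k f) @^-1` [set i]).
  apply/seteqP; split=> x [Dx]; rewrite /preimage /comp /= -iterS iterSr.
    by move=> Xi; split=> //; split=> //; exact: fD.
  by case.
have H i := mpf (sk i) (@subIsetl _ _ _).
split=> [i|]; first by rewrite E; have [] := H i.
apply/funext => i; rewrite /law E; have [_ ->] := H i.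
exact: (congr1 (@^~ i) lk).
Qed.

Lemma simple_itinerary (I : finType) (X : T -> I) n : simple_on X ->
  simple_on (itinerary f X n).
Proof.
move=> sX w; rewrite (_ : _ `&` _ = D `&` \bigcap_(k in [set: 'I_n])
    (D `&` (X \o iter k f) @^-1` [set w k])).
  apply: measurableI => //; apply: fin_bigcap_measurable => // k _.
  by have [+ _] := simple_law_iter k sX; exact.
apply/seteqP; split=> x [Dx].
  by move=> /= <-; split=> // k _; split=> //=; rewrite ffunE.
move=> h; split=> //; apply/ffunP => k; rewrite ffunE.
by have [] := h k Logic.I.
Qed.
End Preserved.

End FiniteRandomVariables.

(** * Entropy of itineraries *)

Section EntropyBounds.
Context d (T : measurableType d) (R : realType).
Variables (mu : {measure set T -> \bar R}) (D : set T).
Hypotheses (mD : measurable D) (muD : mu D = 1%E).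

Lemma law_le_image (I J : finType) (X : T -> I) (Y : T -> J) (phi : I -> J) i :
  simple_on D X -> (forall x, D x -> Y x = phi (X x)) -> law mu D X i <= law mu D Y (phi i).
Proof.
move=> sX YX; rewrite (law_image mD muD _ sX YX) (bigD1 i)//= lerDl.
by apply: sumr_ge0 => *; exact: law_ge0.
Qed.

(** The bound [H(X) <= H(Y) + H(X | Y)], where the conditional law of [X] is replaced
    by any positive kernel [r]: Gibbs' inequality says that this can only increase the
    right-hand side, and leaves [r] free to be a convenient guess. *)
Lemma entropy_le_conditional (I J : finType) (X : T -> I) (Y : T -> J)
    (r : I -> J -> R) :
  simple_on D X -> simple_on D Y ->
  (forall i j, 0 < r i j) -> (forall j, \sum_i r i j <= 1) ->
  law_entropy mu D X <= law_entropy mu D Y -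
    \sum_z law mu D (fun x => (X x, Y x)) z * ln (r z.1 z.2).
Proof.
move=> sX sY r0 r1; set Z := fun x => (X x, Y x).
have sZ : simple_on D Z by exact: simple_pair.
have ZX z : law mu D Z z <= law mu D X z.1 by exact: (law_le_image (phi := fst)).
have ZY z : law mu D Z z <= law mu D Y z.2 by exact: (law_le_image (phi := snd)).
rewrite /law_entropy.
rewrite (sum_law_image mD muD (X := Z) (phi := fst) (fun i => ln (law mu D X i)))//.
rewrite (sum_law_image mD muD (X := Z) (phi := snd) (fun i => ln (law mu D Y i)))//.
apply: (@le_trans _ _ (- \sum_z law mu D Z z * ln (law mu D Z z))).
  rewrite lerN2; apply: ler_sum => z _.
  have := law_ge0 mu D Z z; rewrite le_eqVlt => /predU1P[<-|z0].
    by rewrite !mul0r.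
  by rewrite ler_pM2l// ler_ln ?posrE// (lt_le_trans z0).
apply: (@le_trans _ _ (- \sum_z law mu D Z z * ln (law mu D Y z.2 * r z.1 z.2))).
  apply: gibbs => [z|z|z z0|].
  - exact: law_ge0.
  - by rewrite mulr_ge0 ?law_ge0 1?ltW.
  - by rewrite mulr_gt0// (lt_le_trans z0).
  - rewrite sum_law// -(pair_bigA _ (fun i j => law mu D Y j * r i j))/=.
    rewrite exchange_big/= -(sum_law mD muD sY); apply: ler_sum => j _.
    by rewrite -mulr_sumr ler_piMr ?law_ge0.
rewrite -opprD -big_split/= lerN2; apply: ler_sum => z _.
have := law_ge0 mu D Z z; rewrite le_eqVlt => /predU1P[<-|z0].
  by rewrite !mul0r addr0.
by rewrite lnM ?posrE// ?(lt_le_trans z0)// mulrDr.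
Qed.

Variable f : T -> T.
Hypotheses (fD : set_fun D D f) (mpf : measure_preserving_on mu D f).

Lemma partition_entropy_itinerary (m : nat) (P : 'I_m -> set T) (X : T -> 'I_m) n :
  (forall x i, D x -> (P i x <-> X x = i)) ->
  partition_entropy mu (itinerary_cell D f P (n := n)) =
  law_entropy mu D (itinerary f X n).
Proof.
move=> PX; rewrite /partition_entropy /law_entropy.
have E w : itinerary_cell D f P w = D `&` itinerary f X n @^-1` [set w].
  apply/seteqP; split=> x [Dx] /= h; split=> //.
    by apply/ffunP => k; rewrite ffunE; apply/PX => //; exact: (iter_stable fD).
  by move=> k; apply/PX; [exact: (iter_stable fD)|rewrite -h ffunE].
by congr (- _); apply: eq_bigr => w _; rewrite /law E.
Qed.

(** Each coordinate of the itinerary has the law of [X], by invariance of the measure. *)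
Lemma sum_law_itinerary (I : finType) (X : T -> I) (F : I -> R) n : simple_on D X ->
  \sum_w law mu D (itinerary f X n) w * (\sum_(k < n) F (w k)) =
  n%:R * \sum_i law mu D X i * F i.
Proof.
move=> sX; under eq_bigr do rewrite mulr_sumr.
rewrite exchange_big/= -[n in RHS]card_ord -sum1_card natr_sum mulr_suml.
apply: eq_bigr => k _; rewrite mul1r.
have [_ <-] := simple_law_iter fD mpf k sX.
have si := simple_itinerary mD fD mpf (n := n) sX.
rewrite (sum_law_image mD muD (X := itinerary f X n)
  (Y := X \o iter k f) (phi := fun w => w k))//.
by move=> x Dx; rewrite ffunE.
Qed.

Lemma ltn_add_ord n k (i : 'I_n) (j : 'I_k) : (i + j < n + k)%N.
Proof. by rewrite -addnS leq_add// ltnW. Qed.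

(** Given the [al]-itinerary, guess the [n] labels one by one with [phi], trusting each
    guess with probability about [1 - del].  A right guess costs at most
    [- ln (1 - del)] and a wrong one at most [- ln (del / m)]; by invariance, each
    guess is wrong on a set of measure at most [eta]. *)
Lemma itinerary_entropy_le (m : nat) (A : finType) (X : T -> 'I_m) (al : T -> A)
    (k n : nat) (phi : {ffun 'I_k -> A} -> 'I_m) (del eta : R) :
  simple_on D X -> simple_on D al -> 0 < del < 1 ->
  law mu D (fun x => X x != phi (itinerary f al k x)) true <= eta ->
  law_entropy mu D (itinerary f X n) <= law_entropy mu D (itinerary f al (n + k)) +
    n%:R * (eta * (- ln (del / m%:R)) - ln (1 - del)).
Proof.
move=> sX sal /andP[d0 d1] etaE.
have [x0 Dx0] : exists x, D x.
  apply: contrapT => h; suff D0 : D = set0.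
    by move: muD; rewrite D0 measure0 => -[] /esym/eqP; rewrite oner_eq0.
  by apply/seteqP; split=> // x Dx; case: h; exists x.
have m0 : 0 < m%:R :> R by rewrite ltr0n (leq_ltn_trans _ (ltn_ord (X x0))).
have dm0 : 0 < del / m%:R by rewrite divr_gt0.
have dm1 : del / m%:R <= 1.
  rewrite ler_pdivrMr// mul1r (le_trans (ltW d1))// ler1n.
  by rewrite -(ltr0n R).
(* The share [del] is spread uniformly, which keeps the kernel positive. *)
pose r0 (a b : 'I_m) : R := (if a == b then 1 - del else 0) + del / m%:R.
have r0_gt0 a b : 0 < r0 a b.
  by rewrite ltr_wpDl//; case: ifP => // _; rewrite subr_ge0 ltW.
have r0_sum b : \sum_a r0 a b = 1.
  rewrite big_split/= -big_mkcond/= big_pred1_eq sumr_const card_ord.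
  by rewrite -(@mulr_natr _ (del / _)) mulfVK ?gt_eqF// subrK.
have sI := simple_itinerary mD fD mpf (n := n) sX.
have sJ := simple_itinerary mD fD mpf (n := n + k) sal.
have sk := simple_itinerary mD fD mpf (n := k) sal.
pose guess (i : 'I_n) (v : {ffun 'I_(n + k) -> A}) :=
  phi [ffun j : 'I_k => v (Ordinal (ltn_add_ord i j))].
pose r (w : {ffun 'I_n -> 'I_m}) v := \prod_(i < n) r0 (w i) (guess i v).
have r_gt0 w v : 0 < r w v by apply: prodr_gt0 => i _; exact: r0_gt0.
have r_sum v : \sum_w r w v <= 1.
  rewrite -(bigA_distr_bigA (fun (i : 'I_n) a => r0 a (guess i v))).
  by rewrite big1 // => i _; rewrite r0_sum.
apply: le_trans (entropy_le_conditional sI sJ r_gt0 r_sum) _.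
rewrite lerD2l -sumrN/=.
set Z := (fun x => (itinerary f X n x, itinerary f al (n + k) x)).
have sZ : simple_on D Z by exact: simple_pair.
pose F (b : bool) := if b then - ln (del / m%:R) else - ln (1 - del).
pose e (i : 'I_n) (z : {ffun 'I_n -> 'I_m} * {ffun 'I_(n + k) -> A}) :=
  z.1 i != guess i z.2.
apply: (@le_trans _ _ (\sum_z law mu D Z z * \sum_i F (e i z))).
  apply: ler_sum => z _; rewrite -mulrN ler_wpM2l ?law_ge0//.
  rewrite ln_prod// -sumrN; apply: ler_sum => i _.
  rewrite /e /r0 /F lerNl; case: eqVneq => _ /=; rewrite opprK ?add0r//.
  by rewrite ler_ln ?posrE ?subr_gt0//; [rewrite lerDl ltW|rewrite addr_gt0// subr_gt0].
under eq_bigr do rewrite mulr_sumr.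
rewrite exchange_big/= -[n in leRHS]card_ord -sum1_card natr_sum mulr_suml.
apply: ler_sum => i _; rewrite mul1r.
have sE : simple_on D (fun x => X x != phi (itinerary f al k x)).
  exact: (simple_image mD muD (phi := fun z => z.1 != phi z.2) (simple_pair sX sk)).
have [_ lE] := simple_law_iter fD mpf i sE.
rewrite -(sum_law_image mD muD (X := Z) (Y := (fun x => X x != phi (itinerary f al k x)) \o iter i f)
  (phi := e i))//; last first.
  move=> x Dx; rewrite /e/= ffunE; congr (_ != phi _).
  by apply/ffunP => j; rewrite !ffunE/= -iterD addnC.
rewrite lE big_bool/= lerD//.
  by rewrite ler_wpM2r// lerNr oppr0 ln_le0.
have ln0 : 0 <= - ln (1 - del) by rewrite lerNr oppr0 ln_le0// gerBl ltW.
rewrite -[leRHS]mul1r; apply: ler_wpM2r => //.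
rewrite -(sum_law mD muD sE) (bigD1 false)//= lerDl.
by apply: sumr_ge0 => *; exact: law_ge0.
Qed.
End EntropyBounds.

(** * Entropy of a map with a Markov generator *)

Section MarkovCode.
Context d (T : measurableType d) (R : realType).
Variables (mu : {measure set T -> \bar R}) (D : set T).
Hypotheses (mD : measurable D) (muD : mu D = 1%E).
Variable f : T -> T.
Hypotheses (fD : set_fun D D f) (mpf : measure_preserving_on mu D f).
Variables (M : nat) (al : T -> 'I_M) (beta : 'I_M -> R) (K : R).
Hypotheses (sal : simple_on D al) (beta0 : forall i, 0 < beta i).
(* The symbol [i] multiplies the measure of a cylinder by [beta i], up to the constant
   factor [expR (- K)] and apart from null cylinders. *)
Hypothesis cyl_le : forall n w,
  law mu D (itinerary f al n) w <= \prod_(k < n) beta (w k).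
Hypothesis cyl_ge : forall n w, law mu D (itinerary f al n) w = 0 \/
  expR (- K) * \prod_(k < n) beta (w k) <= law mu D (itinerary f al n) w.

Definition code_entropy : R := \sum_i law mu D al i * (- ln (beta i)).

Lemma code_entropy_ge n :
  n%:R * code_entropy <= law_entropy mu D (itinerary f al n).
Proof.
rewrite /code_entropy -(sum_law_itinerary mD muD fD mpf (fun i => - ln (beta i)) n sal).
rewrite /law_entropy -sumrN; apply: ler_sum => w _.
rewrite -mulrN; have := law_ge0 mu D (itinerary f al n) w.
rewrite le_eqVlt => /predU1P[<-|w0]; first by rewrite !mul0r.
rewrite ler_pM2l// sumrN lerN2 -ln_prod// ler_ln ?posrE//.
  exact: cyl_le.
by rewrite prodr_gt0.
Qed.

Lemma code_entropy_le n :
  law_entropy mu D (itinerary f al n) <= K + n%:R * code_entropy.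
Proof.
rewrite /code_entropy -(sum_law_itinerary mD muD fD mpf (fun i => - ln (beta i)) n sal).
have si := simple_itinerary mD fD mpf (n := n) sal.
rewrite -[K]mulr1 -(sum_law mD muD si) mulr_sumr -big_split/=.
rewrite /law_entropy -sumrN; apply: ler_sum => w _.
rewrite -mulrN (mulrC K) -mulrDr.
have := law_ge0 mu D (itinerary f al n) w.
rewrite le_eqVlt => /predU1P[<-|w0]; first by rewrite !mul0r.
have [h|h] := cyl_ge w; first by move: w0; rewrite h ltxx.
have P0 : 0 < \prod_(k < n) beta (w k) by rewrite prodr_gt0.
rewrite ler_pM2l// sumrN lerNl opprD opprK -ln_prod// -[- K]expRK.
by rewrite -lnM ?posrE ?expR_gt0// ler_ln ?posrE// mulr_gt0// expR_gt0.
Qed.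

(** If it were negative, so would be [K + n * code_entropy] for large [n], although
   entropies are nonnegative. *)
Lemma code_entropy_ge0 : 0 <= code_entropy.
Proof.
have h := @code_entropy_le 1; have [//|hn] := leP 0 code_entropy.
have e0 n : 0 <= K + n%:R * code_entropy.
  apply: le_trans (code_entropy_le n); rewrite /law_entropy oppr_ge0.
  apply: sumr_le0 => w _; rewrite mulr_ge0_le0 ?law_ge0// ln_le0//.
  have si := simple_itinerary mD fD mpf (n := n) sal.
  rewrite -(sum_law mD muD si) (bigD1 w)//= lerDl.
  by apply: sumr_ge0 => *; exact: law_ge0.
have K0 : 0 <= K by have := e0 0; rewrite mul0r addr0.
have := e0 (Num.bound (K / - code_entropy)).
have := @archi_boundP R (K / - code_entropy).
rewrite divr_ge0 ?oppr_ge0 ?(ltW hn)// => /(_ isT).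
by rewrite ltr_pdivrMr ?oppr_gt0//; lra.
Qed.

(* The code is a generator: long itineraries determine any finite partition up to a set
   of small measure. *)
Hypothesis generating : forall m (X : T -> 'I_m) (eta : R), simple_on D X -> 0 < eta ->
  exists k (phi : {ffun 'I_k -> 'I_M} -> 'I_m),
    law mu D (fun x => X x != phi (itinerary f al k x)) true <= eta.

(** The trust parameter [del] is fixed first, to make right guesses cheap; then the
    length [k] of the itineraries is chosen, to make wrong guesses rare enough. *)
Lemma entropy_rate_le m (X : T -> 'I_m) (e : R) : simple_on D X -> 0 < e ->
  exists C, forall n,
    law_entropy mu D (itinerary f X n) <= C + n%:R * (code_entropy + e).
Proof.
move=> sX e0.
pose del : R := 1 - expR (- Num.min (e / 2) 1).
have me : 0 < Num.min (e / 2) 1 by rewrite lt_min ltr01 divr_gt0.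
have d1 : del < 1 by rewrite gtrBl expR_gt0.
have d0 : 0 < del by rewrite subr_gt0 expR_lt1 oppr_lt0.
have lnd : - ln (1 - del) <= e / 2.
  by rewrite /del opprB addrC subrK expRK opprK ge_min lexx.
pose L := `| ln (del / m%:R) | + 1.
have L0 : 0 < L by rewrite ltr_wpDl.
have [k [phi phiE]] := generating sX (divr_gt0 (divr_gt0 e0 (ltr0Sn R 1)) L0).
exists (K + k%:R * code_entropy) => n.
have := itinerary_entropy_le mD muD fD mpf n sX sal _ phiE.
move=> /(_ del); rewrite d0 d1 => /(_ isT) /le_trans; apply.
apply: le_trans (lerD (code_entropy_le (n + k)) (lexx _)) _.
rewrite natrD [n%:R * (_ + e)]mulrDr.
suff : n%:R * (e / 2 / L * - ln (del / m%:R) - ln (1 - del)) <= n%:R * e by lra.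
rewrite ler_wpM2l// [e in leRHS]splitr lerD//.
rewrite mulrAC ler_pdivrMr// ler_wpM2l ?divr_ge0 ?(ltW e0)//.
by have := ler_norm (- ln (del / m%:R)); rewrite /L normrN; lra.
Qed.

Lemma entropy_wrt_le m (P : 'I_m -> set T) : measurable_partition D P ->
  entropy_wrt mu D f P <= code_entropy.
Proof.
move=> [mP [cP tP neP]].
have /choice[X XP] : forall x, exists i : 'I_m, D x -> P i x.
  move=> x; have [Dx|nDx] := pselect (D x).
    have [i _ Pix] : cover [set: 'I_m] P x by rewrite cP.
    by exists i.
  have : D !=set0.
    apply: contrapT => /set0P/negP/negPn/eqP D0.
    by move: muD; rewrite D0 measure0 => -[] /esym/eqP; rewrite oner_eq0.
  move=> [y Dy]; have [i _ _] : cover [set: 'I_m] P y by rewrite cP.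
  by exists i.
have PX x i : D x -> (P i x <-> X x = i).
  move=> Dx; split=> [Pi|<-]; last exact: XP.
  apply: (tP _ _ Logic.I Logic.I); exists x; split=> //; exact: XP.
have sX : simple_on D X.
  move=> i; rewrite (_ : _ `&` _ = D `&` P i); first exact: measurableI.
  by apply/seteqP; split=> x [Dx] /=; rewrite (PX _ _ Dx).
rewrite /entropy_wrt; set u := fun n : nat => _.
(* If the sequence diverges, its limit is 0 by convention. *)
have [cu|ncu] := pselect (cvgn u); last first.
  by rewrite (dvgP ncu); exact: code_entropy_ge0.
apply/ler_addgt0Pr => e e0.
have [C uC] := entropy_rate_le sX (divr_gt0 e0 (ltr0Sn R 1)).
apply: limr_le => //; near=> n.
have n0 : 0 < n%:R :> R by rewrite ltr0n; near: n; exact: nbhs_infty_gt.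
rewrite /u (partition_entropy_itinerary mu fD n PX).
rewrite mulrC ler_pdivrMr//; apply: le_trans (uC n) _.
have : C <= n%:R * (e / 2).
  rewrite -ler_pdivrMr ?divr_gt0//; near: n; exact: nbhs_infty_ger.
by lra.
Unshelve. all: by end_near. Qed.

Hypothesis al_onto : forall i, exists2 x, D x & al x = i.

Lemma KS_entropy_code : KS_entropy mu D f = code_entropy%:E.
Proof.
apply/eqP; rewrite eq_le; apply/andP; split.
  by apply: ub_ereal_sup => _ [m [P [mP ->]]]; rewrite lee_fin entropy_wrt_le.
pose P i := D `&` al @^-1` [set i].
have PX x i : D x -> (P i x <-> al x = i) by move=> Dx; split=> [[]//|].
have mP : measurable_partition D P.
  split; first exact: sal.
  split.
  - apply/seteqP; split=> [x [i _ []]//|x Dx]; exists (al x) => //.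
  - by move=> i j _ _ [x [[_ /= <-] [_ <-]]].
  - by move=> i _; have [x Dx xi] := al_onto i; exists x; split.
suff -> : code_entropy = entropy_wrt mu D f P.
  by apply: ereal_sup_ubound; exists M, P.
apply/esym/cvg_lim => //.
have lim_e : (fun n : nat => n%:R^-1 * K + code_entropy) @ \oo --> code_entropy.
  rewrite -[X in _ --> X]add0r; apply: cvgD; last exact: cvg_cst.
  rewrite -(mul0r K); apply: cvgMl; apply/cvgrPdist_le => e e0.
  near=> n; rewrite sub0r normrN ger0_norm ?invr_ge0//.
  have n0 : 0 < n%:R :> R by rewrite ltr0n; near: n; exact: nbhs_infty_gt.
  rewrite -[e]invrK lef_pV2 ?posrE ?invr_gt0//; near: n; exact: nbhs_infty_ger.
apply: (squeeze_cvgr _ (cvg_cst code_entropy) lim_e).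
near=> n.
have n0 : 0 < n%:R :> R by rewrite ltr0n; near: n; exact: nbhs_infty_gt.
rewrite (partition_entropy_itinerary mu fD n PX) ![n%:R^-1 * _]mulrC.
rewrite ler_pdivlMr// [_ * n%:R]mulrC code_entropy_ge/= ler_pdivrMr//.
by rewrite mulrDl mulfVK ?gt_eqF// [code_entropy * _]mulrC code_entropy_le.
Unshelve. all: by end_near. Qed.
End MarkovCode.

(** * Affine images and grids for Lebesgue measure *)

Section Lebesgue.
Variable R : realType.
Local Notation lam := (@lebesgue_measure R).
Local Notation D := (@unit_itv R).

Lemma measurable_affine (a b : R) (A : set R) : measurable A ->
  measurable ((fun x : R => a * x + b) @^-1` A).
Proof.
move=> mA; rewrite -[X in measurable X]setTI.
have mf : measurable_fun [set: R] (fun x : R => a * x + b).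
  apply: measurable_funD => //; exact: mulrl_measurable.
exact: mf.
Qed.

(** Both sides are measures up to the factor [`|a|], and they agree on half-open
    intervals. *)
Lemma lebesgue_measure_affine (a b : R) (A : set R) : a != 0 -> measurable A ->
  lam ((fun x : R => a * x + b) @^-1` A) = (`|a|^-1%:E * lam A)%E.
Proof.
move=> a0 mA; pose h x : measurableTypeR R := a * x + b.
have mh : measurable_fun [set: measurableTypeR R] h.
  by apply: measurable_funD => //; exact: mulrl_measurable.
have na : 0 < `|a| by rewrite normr_gt0.
pose nu := mscale (NngNum (ltW na)) (pushforward lam h).
have E : lam A = (`|a|%:E * lam (h @^-1` A))%E.
  suff -> : lam A = nu mh A by [].
  apply: lebesgue_measure_unique => // _ [[p q]] _ <-.
  rewrite -[RHS]/(`|a|%:E * lam (h @^-1` `]p, q]%classic))%E.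
  have -> : h @^-1` `]p, q]%classic =
      if 0 < a then `](p - b) / a, (q - b) / a]%classic
      else `[(q - b) / a, (p - b) / a[%classic.
    apply/seteqP; case: ltP => aE; split=> x /=; rewrite /h !in_itv/=.
    - by rewrite ltr_pdivrMr// ler_pdivlMr// mulrC; move=> /andP[? ?]; apply/andP; split; lra.
    - by rewrite ltr_pdivrMr// ler_pdivlMr// mulrC; move=> /andP[? ?]; apply/andP; split; lra.
    - have an : a < 0 by rewrite lt_neqAle a0.
      by rewrite ler_ndivrMr// ltr_ndivlMr// mulrC; move=> /andP[? ?]; apply/andP; split; lra.
    - have an : a < 0 by rewrite lt_neqAle a0.
      by rewrite ler_ndivrMr// ltr_ndivlMr// mulrC; move=> /andP[? ?]; apply/andP; split; lra.
  case: ltP => aE; rewrite !lebesgue_measure_itv/= !lte_fin.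
  - rewrite ltr_pM2r ?invr_gt0// ltrD2r; case: ifP => _; last by rewrite mule0.
    by rewrite -EFinD -EFinM gtr0_norm//; congr EFin; field; rewrite gt_eqF.
  - have an : a < 0 by rewrite lt_neqAle a0.
    rewrite ltr_nM2r ?invr_lt0// ltrD2r; case: ifP => _; last by rewrite mule0.
    by rewrite -EFinD -EFinM ltr0_norm//; congr EFin; field; rewrite lt_eqF.
by rewrite E muleA -EFinM mulVf ?gt_eqF// mul1e.
Qed.

Lemma lebesgue_null_point (p : R) (A : set R) : A `<=` [set p] -> lam A = 0%E.
Proof.
by move/subset_set1 => [] ->; rewrite ?measure0 ?lebesgue_measure_set1.
Qed.

Lemma lebesgue_split_itv (a b c : R) (B : set R) : a <= b <= c ->
  measurable (`[a, c] `&` B) ->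
  lam (`[a, c] `&` B) = (lam (`[a, b] `&` B) + lam (`[b, c] `&` B))%E.
Proof.
move=> /andP[ab bc] mB.
have mS (i : interval R) : [set` i] `<=` `[a, c]%classic -> measurable ([set` i] `&` B).
  move=> s; rewrite -(setIidl s) -setIA; exact: measurableI.
have s1 : `[a, b]%classic `<=` `[a, c]%classic.
  by move=> x /=; rewrite !in_itv/= => /andP[-> /le_trans]; exact.
have s2 : `]b, c]%classic `<=` `[a, c]%classic.
  by move=> x /=; rewrite !in_itv/= => /andP[/ltW /(le_trans ab) -> ->].
have s3 : `[b, c]%classic `<=` `[a, c]%classic.
  by move=> x /=; rewrite !in_itv/= => /andP[/(le_trans ab) -> ->].
have -> : lam (`[b, c] `&` B) = lam (`]b, c] `&` B).
  have -> : `[b, c]%classic `&` B = (`]b, c] `&` B) `|` ([set b] `&` B).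
    by rewrite -setIUl setUC setU1itv.
  rewrite measureU; last 1 first.
  - apply/seteqP; split=> // x [[+ _] [/= xb _]].
    by rewrite /= in_itv/= xb ltxx.
  - by rewrite [X in (_ + X)%E](@lebesgue_null_point b) ?adde0// => x [].
  - exact: mS.
  - by rewrite -set_itv1; apply: mS => x; rewrite /= !in_itv/= => /andP[b1 b2];
      rewrite (le_trans ab b1) (le_trans b2 bc).
rewrite -measureU; first last.
- apply/seteqP; split=> // x [[+ _] [+ _]].
  by rewrite /= !in_itv/= => /andP[_ xb] /andP[/(le_lt_trans xb)]; rewrite ltxx.
- exact: mS.
- exact: mS.
congr lam; rewrite -setIUl; congr (_ `&` _).
apply/seteqP; split=> x; rewrite /= !in_itv/=; last first.
  by move=> [/andP[-> /le_trans ->]|/andP[/ltW /(le_trans ab) -> ->]].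
move=> /andP[ax xc]; case: (leP x b) => xb; first by left; rewrite ax.
by right; rewrite xc.
Qed.

(** Consecutive closed intervals overlap in single points, which are null sets. *)
Lemma lebesgue_split_grid (t : nat -> R) (M : nat) (B : set R) :
  (forall i, (i < M)%N -> t i <= t i.+1) ->
  measurable (`[t 0%N, t M] `&` B) ->
  lam (`[t 0%N, t M] `&` B) = (\sum_(i < M) lam (`[t i, t i.+1] `&` B))%E.
Proof.
elim: M => [|M IH] tS mB.
  by rewrite big_ord0 (@lebesgue_null_point (t 0%N))// set_itv1 => x [].
have t0M : t 0%N <= t M.
  have /(_ M (leqnn M)) : forall k, (k <= M)%N -> t 0%N <= t k; last by [].
  by elim=> // k IHk kM; rewrite (le_trans (IHk (ltnW kM)))// tS// ltnW.
rewrite big_ord_recr/= -IH; last 2 first.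
- by move=> i iM; apply: tS; exact: ltnW.
- have s : `[t 0%N, t M]%classic `<=` `[t 0%N, t M.+1]%classic.
    by move=> x /=; rewrite !in_itv/= => /andP[-> /le_trans]; apply; exact: tS.
  by rewrite -(setIidl s) -setIA; exact: measurableI.
by apply: lebesgue_split_itv => //; rewrite t0M tS.
Qed.

End Lebesgue.

(** * Piecewise affine interpolation *)

Section Interpolation.
Variable R : realType.
Implicit Types (t y : nat -> R) (M : nat).

(** The truncation of [z] to [0, 1]; written with absolute values, it is visibly
    continuous. *)
Definition clamp (z : R) : R := (1 + `|z| - `|z - 1|) / 2.

Lemma clamp0 z : z <= 0 -> clamp z = 0.
Proof. by move=> z0; rewrite /clamp !ler0_norm//; [lra|lra]. Qed.

Lemma clamp1 z : 1 <= z -> clamp z = 1.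
Proof. by move=> z1; rewrite /clamp !ger0_norm//; [lra|lra|lra]. Qed.

Lemma clamp_id z : 0 <= z <= 1 -> clamp z = z.
Proof.
by move=> /andP[z0 z1]; rewrite /clamp ger0_norm// ler0_norm//; [lra|lra].
Qed.

Lemma clamp_continuous : continuous clamp.
Proof.
move=> z; apply: cvgMl; apply: cvgB.
  by apply: cvgD; [exact: cvg_cst|exact: (@norm_continuous _ R^o)].
apply: (@cvg_comp _ _ _ (fun z : R => z - 1) (@Num.norm _ R) _ (nbhs (z - 1))).
  by apply: cvgB; [exact: cvg_id|exact: cvg_cst].
exact: (@norm_continuous _ R^o).
Qed.

(** Written as a sum of truncated ramps, the interpolation of the values [y i] at the
    nodes [t i] is continuous without any gluing. *)
Definition interpolation M t y (x : R) : R :=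
  y 0%N + \sum_(i < M) (y i.+1 - y i) * clamp ((x - t i) / (t i.+1 - t i)).

Lemma interpolation_continuous M t y : continuous (interpolation M t y).
Proof.
elim: M => [|M IH] x.
  rewrite (_ : interpolation 0 t y = cst (y 0%N)); first exact: cvg_cst.
  by apply/funext => z; rewrite /interpolation big_ord0 addr0.
rewrite (_ : interpolation M.+1 t y = (fun z => interpolation M t y z +
    (y M.+1 - y M) * clamp ((z - t M) / (t M.+1 - t M)))); last first.
  by apply/funext => z; rewrite /interpolation big_ord_recr addrA.
apply: cvgD; first exact: IH.
apply: cvgMr.
apply: (@cvg_comp _ _ _ (fun x : R => (x - t M) / (t M.+1 - t M)) clamp).
  by apply: cvgMl; apply: cvgB; [exact: cvg_id|exact: cvg_cst].
exact: clamp_continuous.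
Qed.

Lemma ler_nodes M t i j : (forall i, (i < M)%N -> t i < t i.+1) ->
  (i <= j <= M)%N -> t i <= t j.
Proof.
move=> tS /andP[]; elim: j => [|j IH]; first by rewrite leqn0 => /eqP ->.
rewrite leq_eqVlt => /predU1P[->//|ij jM].
by rewrite (le_trans (IH _ (ltnW jM)))// ltW// tS.
Qed.

Lemma interpolationE M t y i x : (forall i, (i < M)%N -> t i < t i.+1) ->
  (i < M)%N -> t i <= x <= t i.+1 ->
  interpolation M t y x = y i + (y i.+1 - y i) * ((x - t i) / (t i.+1 - t i)).
Proof.
move=> tS iM /andP[ix xi].
have d0 j : (j < M)%N -> 0 < t j.+1 - t j by move=> /tS; rewrite subr_gt0.
rewrite /interpolation -(big_mkord predT (fun j =>
   (y j.+1 - y j) * clamp ((x - t j) / (t j.+1 - t j)))).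
rewrite (big_cat_nat (n := i))//=; last exact: ltnW.
rewrite [X in _ + (_ + X)]big_ltn// clamp_id; last first.
  by rewrite divr_ge0 ?subr_ge0 ?(ltW (tS _ _))//= ler_pdivrMr ?d0// mul1r lerD2r.
rewrite [X in _ + (_ + (_ + X))]big_nat_cond [X in _ + (_ + (_ + X))]big1 ?addr0; last first.
  move=> j /andP[/andP[ij jM] _]; rewrite clamp0 ?mulr0//.
  rewrite pmulr_lle0 ?invr_gt0 ?d0// subr_le0 (le_trans xi)//.
  by apply: (ler_nodes tS); rewrite ij ltnW.
rewrite addrA; congr (_ + _).
rewrite big_nat_cond (eq_bigr (fun j => y j.+1 - y j)); last first.
  move=> j /andP[/andP[_ ji] _]; have jM := ltn_trans ji iM.
  rewrite clamp1 ?mulr1// ler_pdivlMr ?d0// mul1r lerD2r (le_trans _ ix)//.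
  by apply: (ler_nodes tS); rewrite ji ltnW.
by rewrite -big_nat_cond telescope_sumr// subrKC.
Qed.

(** On the open piece the derivative is constant, and both properties are local. *)
Lemma affine_derive1_continuous (g : R -> R) (a b p q x : R) : p < x < q ->
  (forall z, p < z < q -> g z = a * z + b) ->
  derivable g x 1 /\ {for x, continuous (derive1 g)}.
Proof.
move=> pxq gE.
have H z : p < z < q -> is_derive z 1 g a.
  move=> pzq; apply: (@near_eq_is_derive _ _ _ (a *: (id : R -> R) + cst b)).
    have /near_in_itvoo zI : z \in `]p, q[ by rewrite in_itv.
    by near=> w; rewrite gE//; near: w; apply: filterS zI => w; rewrite in_itv.
  by apply: is_derive_eq; rewrite addr0 [LHS]mulr1.
split; first by have [] := H x pxq.
have E z : p < z < q -> derive1 g z = a.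
  by move=> pzq; rewrite derive1E; have [_ ->] := H z pzq.
have -> : {for x, continuous (derive1 g)} = (derive1 g @ x --> a) by rewrite /prop_for/continuous_at E.
apply: cvg_near_cst.
have /near_in_itvoo zI : x \in `]p, q[ by rewrite in_itv.
by apply: filterS zI => w; rewrite in_itv/= => /E ->.
Unshelve. all: by end_near. Qed.

End Interpolation.

(** * Markov zigzag maps *)

Definition grid_cell (R : realType) (N k : nat) : set R :=
  `[k%:R / N%:R, k.+1%:R / N%:R].

Section Zigzag.
Variable R : realType.
Local Notation lam := (@lebesgue_measure R).
Local Notation D := (@unit_itv R).

Definition node (ell : nat -> R) (i : nat) : R := \sum_(j < i) ell j.

Definition height (N : nat) (u : nat -> nat) (i : nat) : R := (u i)%:R / N%:R.

Definition zigzag N M ell u : R -> R := interpolation M (node ell) (height N u).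

Definition edge (u : nat -> nat) (i : nat) : nat := minn (u i) (u i.+1).

(** The data of a Markov zigzag map on [M] laps: [ell i] is the length of the [i]-th
    lap, [u i] and [u i.+1] are the heights of its end points in units of [1/N], and
    [c i] is the number of the cell that contains the lap.  The balance condition
    [zz_balance] is what makes the map preserve Lebesgue measure, [zz_cell] and
    [zz_grid] make it Markov, and [zz_expand] says that slopes are larger than 1. *)
Record markov_zigzag (N M : nat) (ell : nat -> R) (u c : nat -> nat) : Prop :=
  MarkovZigzag {
    zz_gt0 : forall i, (i < M)%N -> 0 < ell i;
    zz_sum : node ell M = 1;
    zz_adj : forall i, (i < M)%N -> u i.+1 = (u i).+1 \/ u i = (u i.+1).+1;
    zz_bound : forall i, (i <= M)%N -> (u i <= N)%N;
    zz_cell : forall i, (i < M)%N ->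
      (c i)%:R / N%:R <= node ell i /\ node ell i.+1 <= (c i).+1%:R / N%:R;
    zz_grid : forall k, (k <= N)%N -> exists2 i, (i <= M)%N & node ell i = k%:R / N%:R;
    zz_balance : forall k, (k < N)%N -> \sum_(i < M | edge u i == k) ell i = N%:R^-1;
    zz_expand : forall i, (i < M)%N -> N%:R * ell i < 1 }.

Variables (N M : nat) (ell : nat -> R) (u c : nat -> nat).
Hypotheses (N0 : (0 < N)%N) (Z : markov_zigzag N M ell u c).
Local Notation t := (node ell).
Local Notation g := (zigzag N M ell u).
Local Notation J := (@grid_cell R N).

Let N0R : 0 < N%:R :> R. Proof. by rewrite ltr0n. Qed.

Lemma nodeS i : t i.+1 = t i + ell i.
Proof. by rewrite /node big_ord_recr. Qed.

Lemma node0 : t 0 = 0. Proof. by rewrite /node big_ord0. Qed.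

Lemma node_ltS i : (i < M)%N -> t i < t i.+1.
Proof. by move=> iM; rewrite nodeS ltrDl (zz_gt0 Z). Qed.

Lemma node_le i j : (i <= j <= M)%N -> t i <= t j.
Proof. exact: (ler_nodes node_ltS). Qed.

Lemma node_itv i : (i < M)%N -> `[t i, t i.+1]%classic `<=` D.
Proof.
move=> iM x; rewrite /unit_itv/= !in_itv/= => /andP[ix xi]; apply/andP; split.
  by apply: le_trans ix; rewrite -node0; apply: node_le; rewrite (ltnW iM).
by apply: le_trans xi _; rewrite -(zz_sum Z); apply: node_le; rewrite iM leqnn.
Qed.

Lemma lap_count_gt0 : (0 < M)%N.
Proof.
rewrite lt0n; apply: contra_eq_neq (zz_sum Z) => ->.
by rewrite node0 eq_sym oner_eq0.
Qed.

Definition lap_affine i (x : R) : R :=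
  (u i)%:R / N%:R + ((u i.+1)%:R - (u i)%:R) / (N%:R * ell i) * (x - t i).

Lemma zigzagE i x : (i < M)%N -> t i <= x <= t i.+1 -> g x = lap_affine i x.
Proof.
move=> iM xi; rewrite /zigzag (interpolationE _ node_ltS iM xi) /height.
rewrite /lap_affine nodeS addrAC subrr add0r; congr (_ + _); field.
by rewrite !gt_eqF// (zz_gt0 Z).
Qed.

Lemma zigzag_node i : (i <= M)%N -> g (t i) = (u i)%:R / N%:R.
Proof.
rewrite leq_eqVlt => /predU1P[->|iM]; last first.
  by rewrite (zigzagE iM) ?lexx ?ltW ?node_ltS// /lap_affine subrr mulr0 addr0.
have := lap_count_gt0; case: (M) Z node_ltS zigzagE => // m Zm tm gE _.
rewrite (gE m)// ?lexx ?ltW ?tm// /lap_affine nodeS addrAC subrr add0r.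
by field; rewrite !gt_eqF// (zz_gt0 Zm).
Qed.

Lemma edge_lt i : (i < M)%N -> (edge u i < N)%N.
Proof.
move=> iM; rewrite /edge; have b1 := zz_bound Z (ltnW iM); have b2 := zz_bound Z iM.
by have [h|h] := zz_adj Z iM; move: b1 b2; rewrite h; lia.
Qed.

Lemma lap_slope i : (i < M)%N ->
  `|((u i.+1)%:R - (u i)%:R) / (N%:R * ell i)| = (N%:R * ell i)^-1.
Proof.
move=> iM; have l0 := zz_gt0 Z iM.
rewrite normrM normfV [X in _ / X]gtr0_norm ?mulr_gt0//.
suff -> : `|(u i.+1)%:R - (u i)%:R : R| = 1 by rewrite mul1r.
have [->|->] := zz_adj Z iM; rewrite -natr1; first by rewrite addrAC subrr add0r normr1.
by rewrite opprD addNKr normrN1.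
Qed.

(** A lap covers exactly one grid cell, so that preimages of sets within a lap are affine
    preimages of sets within a cell. *)
Lemma lap_affine_itv i x : (i < M)%N ->
  (t i <= x <= t i.+1) =
  ((edge u i)%:R / N%:R <= lap_affine i x <= (edge u i).+1%:R / N%:R).
Proof.
move=> iM; have l0 := zz_gt0 Z iM.
rewrite /lap_affine /edge nodeS.
set s := (x - t i) / ell i.
have -> : (t i <= x <= t i + ell i) = (0 <= s <= 1).
  by rewrite /s ler_pdivlMr// ler_pdivrMr// mul0r mul1r subr_ge0 lerBlDl.
have -> : (u i)%:R / N%:R + ((u i.+1)%:R - (u i)%:R) / (N%:R * ell i) * (x - t i)
  = ((u i)%:R + ((u i.+1)%:R - (u i)%:R) * s) / N%:R.
  by rewrite /s; field; rewrite !gt_eqF.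
rewrite !ler_pM2r ?invr_gt0//.
have [h|h] := zz_adj Z iM.
  by rewrite h (minn_idPl (leqnSn _)) -natr1; apply/idP/idP => /andP[? ?]; apply/andP; split; lra.
by rewrite h (minn_idPr (leqnSn _)) -natr1; apply/idP/idP => /andP[? ?]; apply/andP; split; lra.
Qed.

Lemma lap_preimage i (A : set R) : (i < M)%N ->
  `[t i, t i.+1] `&` g @^-1` A =
  lap_affine i @^-1` (A `&` J (edge u i)).
Proof.
move=> iM; apply/seteqP; split=> x /=; rewrite /grid_cell/= !in_itv/=.
  by move=> [xi]; rewrite (zigzagE iM xi) => Ax; split=> //; rewrite -lap_affine_itv.
by move=> [Ax]; rewrite -lap_affine_itv// => xi; split=> //; rewrite (zigzagE iM xi).
Qed.

Lemma lap_preimage_measure i (A : set R) : (i < M)%N ->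
  measurable (A `&` J (edge u i)) ->
  measurable (`[t i, t i.+1] `&` g @^-1` A) /\
  lam (`[t i, t i.+1] `&` g @^-1` A) =
    ((N%:R * ell i)%:E * lam (A `&` J (edge u i)))%E.
Proof.
move=> iM mA; rewrite lap_preimage//.
have l0 := zz_gt0 Z iM.
set s := ((u i.+1)%:R - (u i)%:R) / (N%:R * ell i).
have -> : lap_affine i = fun x => s * x + ((u i)%:R / N%:R - s * t i).
  by apply/funext => x; rewrite /lap_affine -/s; ring.
split; first exact: measurable_affine.
rewrite lebesgue_measure_affine//; last first.
  by rewrite -normr_gt0 lap_slope// invr_gt0 mulr_gt0.
by rewrite lap_slope// invrK.
Qed.

Lemma unit_itvE : D = `[t 0, t M]%classic.
Proof. by rewrite node0 (zz_sum Z). Qed.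

Lemma find_lap x : D x -> exists2 i, (i < M)%N & t i <= x <= t i.+1.
Proof.
rewrite unit_itvE/= in_itv/= => /andP[x0 x1].
have : forall m, (m <= M)%N -> (0 < m)%N -> x <= t m ->
    exists2 i, (i < m)%N & t i <= x <= t i.+1.
  elim=> // m IH mM _ xm; have [xm'|xm'] := leP x (t m).
    case: m IH mM xm xm' => [|m] IH mM xm xm'; first by exists 0%N => //; rewrite x0.
    by have [i im ix] := IH (ltnW mM) isT xm'; exists i => //; rewrite ltnW.
  by exists m => //; rewrite xm ltW.
by move/(_ M (leqnn M) lap_count_gt0 x1).
Qed.

Lemma set_fun_zigzag : set_fun D D g.
Proof.
move=> x /find_lap[i iM ix]; rewrite /unit_itv/= in_itv/=.
have := ix; rewrite lap_affine_itv// -zigzagE// => /andP[e1 e2].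
rewrite (le_trans _ e1) ?divr_ge0//= (le_trans e2)//.
by rewrite ler_pdivrMr// mul1r ler_nat edge_lt.
Qed.

Lemma lebesgue_split_cells (B : set R) : measurable B -> B `<=` D ->
  lam B = (\sum_(k < N) lam (B `&` J k))%E.
Proof.
move=> mB BD; pose s (k : nat) : R := k%:R / N%:R.
have DE : D = `[s 0%N, s N]%classic by rewrite /s mul0r divff ?gt_eqF.
rewrite -[in LHS](setIidr BD) DE lebesgue_split_grid; last 2 first.
- by move=> i _; rewrite /s ler_pM2r ?invr_gt0// ler_nat.
- by rewrite -DE; apply: measurableI => //; exact: measurable_itv.
by apply: eq_bigr => k _; rewrite setIC.
Qed.

(** Summing over laps, grouped by the cell that they cover, the part of [A] in that cell
    gets the total factor [N * (1/N) = 1]. *)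
Lemma zigzag_preserves : measure_preserving_on lam D g.
Proof.
move=> A mA AD.
have mJ k : measurable (A `&` J k) by apply: measurableI => //; exact: measurable_itv.
have mD : measurable (D `&` g @^-1` A).
  rewrite (_ : _ `&` _ = \bigcup_(i in `I_M) (`[t i, t i.+1] `&` g @^-1` A)).
    by apply: fin_bigcup_measurable => // i iM; have [] := lap_preimage_measure iM (mJ _).
  apply/seteqP; split=> [x [Dx Ax]|x [i iM [xi Ax]]].
    by have [i iM xi] := find_lap Dx; exists i => //; split=> //=; rewrite in_itv.
  by split=> //; exact: (node_itv iM).
split=> //; rewrite unit_itvE in mD *.
rewrite lebesgue_split_grid//; last by move=> i /node_ltS/ltW.
rewrite (lebesgue_split_cells mA AD).
rewrite (eq_bigr (fun i : 'I_M => ((N%:R * ell i)%:E * lam (A `&` J (edge u i)))%E));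
  last by move=> i _; have [_ ->] := lap_preimage_measure (ltn_ord i) (mJ _).
rewrite (partition_big (fun i : 'I_M => Ordinal (edge_lt (ltn_ord i))) predT)//=.
apply: eq_bigr => k _.
rewrite (eq_bigr (fun i : 'I_M => ((N%:R * ell i)%:E * lam (A `&` J k))%E)); last first.
  by move=> i /eqP <-.
rewrite -ge0_sume_distrl; last first.
  by move=> i _; rewrite lee_fin mulr_ge0// ltW// (zz_gt0 Z).
rewrite sumEFin -mulr_sumr.
rewrite (eq_bigl (fun i : 'I_M => edge u i == k))//.
by rewrite (zz_balance Z (ltn_ord k)) divff ?mul1e// gt_eqF.
Qed.

(** Half-open laps, the last one closed, to have a partition of [0, 1]. *)
Definition in_lap i (x : R) : Prop := t i <= x /\ (x < t i.+1 \/ i.+1 = M).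

Lemma in_lap_exists x : exists i : 'I_M, D x -> in_lap i x.
Proof.
have [Dx|] := pselect (D x); last by exists (Ordinal lap_count_gt0).
have [i iM /andP[ix]] := find_lap Dx; rewrite le_eqVlt => /predU1P[xi|xi].
  have [iM1|iM1] := ltnP i.+1 M.
    by exists (Ordinal iM1) => _; split; rewrite /= xi//; left; exact: node_ltS.
  exists (Ordinal iM) => _; split=> //=; right.
  by apply/eqP; rewrite eqn_leq iM.
by exists (Ordinal iM) => _; split=> //; left.
Qed.

Definition lap_index : R -> 'I_M := projT1 (choice in_lap_exists).

Lemma lap_indexP x : D x -> in_lap (lap_index x) x.
Proof. by rewrite /lap_index; case: choice => h /= hP; exact: hP. Qed.

Lemma in_lap_lt i j x : (i < j)%N -> (j < M)%N -> in_lap i x -> in_lap j x -> False.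
Proof.
move=> ij jM [_ xi] [jx _].
have : t i.+1 <= t j by apply: node_le; rewrite ij ltnW.
case: xi => [xi /le_trans/(_ jx)|iM]; first by rewrite leNgt xi.
by move: ij jM; rewrite -iM ltnS; lia.
Qed.

Lemma lap_indexE (i : 'I_M) x : D x -> in_lap i x -> lap_index x = i.
Proof.
move=> Dx xi; have xj := lap_indexP Dx; apply/val_inj => /=.
case: (ltngtP (lap_index x) i) => // h; exfalso.
  exact: (in_lap_lt h _ xj xi).
exact: (in_lap_lt h _ xi xj).
Qed.

Lemma lap_index_itv x : D x -> t (lap_index x) <= x <= t (lap_index x).+1.
Proof.
move=> Dx; have [-> /=] := lap_indexP Dx; case=> [/ltW//|->].
by move: Dx; rewrite (zz_sum Z) /unit_itv/= in_itv/= => /andP[].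
Qed.

Definition fiber (i : 'I_M) : set R := D `&` lap_index @^-1` [set i].

Lemma fiberE (i : 'I_M) :
  fiber i = if (i.+1 == M)%N then `[t i, t i.+1]%classic else `[t i, t i.+1[%classic.
Proof.
apply/seteqP; split=> x.
  move=> [Dx /= xi]; have := lap_index_itv Dx; have [_] := lap_indexP Dx; rewrite xi.
  by case: eqP => iM /= [h|//]; rewrite in_itv/= => /andP[-> ?]; rewrite ?h.
move=> xi; have Dx : D x.
  apply: (node_itv (ltn_ord i)); case: ifP xi => // _; rewrite /= !in_itv/=.
  by move=> /andP[-> /ltW].
split=> //; apply: lap_indexE => //.
by case: eqP xi => [iM|_]; rewrite /= in_itv/= => /andP[ix xi]; split=> //; [right|left].
Qed.

Lemma measurable_fiber i : measurable (fiber i).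
Proof. by rewrite fiberE; case: ifP => _; exact: measurable_itv. Qed.

Lemma fiber_measure (i : 'I_M) (B : set R) : measurable (`[t i, t i.+1] `&` B) ->
  measurable (fiber i `&` B) /\ lam (fiber i `&` B) = lam (`[t i, t i.+1] `&` B).
Proof.
move=> mB; have FB : fiber i `&` B = fiber i `&` (`[t i, t i.+1] `&` B).
  apply/seteqP; split=> x [xi]; last by case.
  move=> Bx; split=> //; split=> //.
  by case: xi => Dx /= <-; rewrite in_itv/=; exact: lap_index_itv.
have mFB : measurable (fiber i `&` B).
  by rewrite FB; apply: measurableI => //; exact: measurable_fiber.
split=> //; rewrite fiberE in mFB *; case: eqP mFB => // _ mFB.
have E : `[t i, t i.+1]%classic `&` B = (`[t i, t i.+1[ `&` B) `|` ([set t i.+1] `&` B).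
  by rewrite -setIUl setUitv1// bnd_simp ltW// node_ltS.
rewrite E measureU//.
- by rewrite [X in (_ + X)%E](@lebesgue_null_point _ (t i.+1)) ?adde0// => x [].
- rewrite (_ : _ `&` _ = [set t i.+1] `&` (`[t i, t i.+1] `&` B)).
    exact: measurableI.
  rewrite setIA; congr (_ `&` _); apply/esym/setIidl => x /= ->.
  by rewrite in_itv/= lexx andbT ltW// node_ltS.
- apply/seteqP; split=> // x [[xi _] [/= xE _]]; move: xi.
  by rewrite /= in_itv/= xE ltxx andbF.
Qed.

Definition cylinder n (v : nat -> 'I_M) : set R :=
  [set x | D x /\ forall k, (k < n)%N -> lap_index (iter k g x) = v k].

Lemma cylinderS n v :
  cylinder n.+1 v = fiber (v 0%N) `&` g @^-1` (cylinder n (v \o S)).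
Proof.
apply/seteqP; split=> x.
  move=> [Dx xv]; split; first by split=> //; exact: (xv 0%N).
  by split; [exact: set_fun_zigzag|move=> k kn; rewrite -iterSr; exact: xv].
move=> [[Dx x0] [_ xv]]; split=> // -[//|k] kn.
by rewrite iterSr; exact: xv.
Qed.

Lemma cylinder_sub n v : cylinder n v `<=` D.
Proof. by move=> x []. Qed.

Lemma measurable_cylinder n v : measurable (cylinder n v).
Proof.
elim: n v => [|n IH] v.
  rewrite (_ : cylinder 0 v = D); first exact: measurable_itv.
  by apply/seteqP; split=> x // [].
rewrite cylinderS.
have mJ : measurable (cylinder n (v \o S) `&` J (edge u (v 0%N))).
  by apply: measurableI; [exact: IH|exact: measurable_itv].
have [m1 _] := lap_preimage_measure (ltn_ord (v 0%N)) mJ.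
by have [] := fiber_measure m1.
Qed.

Lemma cylinder_measureS n v : lam (cylinder n.+1 v) =
  ((N%:R * ell (v 0%N))%:E * lam (cylinder n (v \o S) `&` J (edge u (v 0%N))))%E.
Proof.
rewrite cylinderS.
have mJ : measurable (cylinder n (v \o S) `&` J (edge u (v 0%N))).
  by apply: measurableI; [exact: measurable_cylinder|exact: measurable_itv].
have [m1 <-] := lap_preimage_measure (ltn_ord (v 0%N)) mJ.
by have [_ ->] := fiber_measure m1.
Qed.

Lemma lebesgue_unit_itv : lam D = 1%E.
Proof. by rewrite lebesgue_measure_itv/= lte_fin ltr01 oppr0 adde0. Qed.

Local Notation beta i := (N%:R * ell i).

Let beta_gt0 (i : 'I_M) : 0 < beta i.
Proof. by rewrite mulr_gt0// (zz_gt0 Z). Qed.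

(** Taking the preimage by one lap [i] multiplies measures by at most [N * ell i]. *)
Lemma cylinder_measure_le n v :
  (lam (cylinder n v) <= (\prod_(k < n) beta (v k))%:E)%E.
Proof.
elim: n v => [|n IH] v.
  rewrite big_ord0 -lebesgue_unit_itv; apply: le_measure; rewrite ?inE.
  - exact: measurable_cylinder.
  - exact: measurable_itv.
  - exact: cylinder_sub.
rewrite cylinder_measureS big_ord_recl [leRHS]EFinM lee_wpmul2l//.
  by rewrite lee_fin (ltW (beta_gt0 _)).
apply: le_trans (IH (v \o S)); apply: le_measure; rewrite ?inE.
- by apply: measurableI; [exact: measurable_cylinder|exact: measurable_itv].
- exact: measurable_cylinder.
- exact: subIsetl.
Qed.

Lemma cell_inter_null k l : (k < l)%N -> J k `&` J l `<=` [set l%:R / N%:R].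
Proof.
move=> kl x []; rewrite /grid_cell/= !in_itv/= => /andP[_ xk] /andP[lx _].
apply/eqP; rewrite eq_le lx andbT (le_trans xk)//.
by rewrite ler_pM2r ?invr_gt0// ler_nat.
Qed.

Lemma grid_cell_measure k : lam (J k) = (N%:R^-1)%:E.
Proof.
rewrite lebesgue_measure_itv/= lte_fin ltr_pM2r ?invr_gt0// ltr_nat ltnSn.
by rewrite -EFinD -mulrBl -natr1 addrAC subrr add0r mul1r.
Qed.

(** The next lap lies in a single cell.  Either this is the cell covered by the present
    lap, and the factor [N * ell i] is exact, or both cells have at most a point in
    common and the cylinder is null. *)
Lemma cylinder_measure_ge n v : lam (cylinder n v) = 0%E \/
  ((N%:R^-1 * \prod_(k < n) beta (v k))%:E <= lam (cylinder n v))%E.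
Proof.
elim: n v => [|n IH] v.
  right; rewrite big_ord0 mulr1 (_ : cylinder 0 v = D).
    by rewrite [leRHS]lebesgue_unit_itv lee_fin invf_le1// ler1n.
  by apply/seteqP; split=> x // [].
rewrite cylinder_measureS big_ord_recl mulrCA [X in (X <= _)%E]EFinM.
suff : lam (cylinder n (v \o S) `&` J (edge u (v 0%N))) = 0%E \/
    ((N%:R^-1 * \prod_(k < n) beta ((v \o S) k))%:E <=
     lam (cylinder n (v \o S) `&` J (edge u (v 0%N))))%E.
  case=> [->|h]; [by left; rewrite mule0|right].
  by rewrite lee_wpmul2l// lee_fin (ltW (beta_gt0 _)).
case: n IH => [|n] IH.
  right; rewrite big_ord0 mulr1 (_ : cylinder 0 _ `&` _ = J (edge u (v 0%N))).
    by rewrite grid_cell_measure.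
  apply/seteqP; split=> x; first by case.
  move=> Jx; split=> //; move: Jx; rewrite /grid_cell/= in_itv/= => /andP[x0 x1].
  split=> //; rewrite /unit_itv/= in_itv/= (le_trans _ x0) ?divr_ge0//=.
  rewrite (le_trans x1)// ler_pdivrMr// mul1r ler_nat.
  by apply: edge_lt.
have cJ : cylinder n.+1 (v \o S) `<=` J (c (v 1%N)).
  move=> x [Dx /(_ 0%N isT) /= x1]; have := lap_index_itv Dx; rewrite x1 => /andP[a1 a2].
  have [b1 b2] := zz_cell Z (ltn_ord (v 1%N)).
  by rewrite /grid_cell/= in_itv/= (le_trans b1 a1) (le_trans a2 b2).
case: (ltngtP (c (v 1%N)) (edge u (v 0%N))) => h.
- left; apply: lebesgue_null_point => x [/cJ xc xe].
  exact: (cell_inter_null h).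
- left; apply: lebesgue_null_point => x [/cJ xc xe].
  exact: (cell_inter_null h).
- by rewrite -h (setIidl cJ).
Qed.

(** Two points in the same lap are [N * ell i < 1] times as far apart as their images. *)
Lemma lap_itinerary_contracts : exists2 q : R, 0 <= q < 1 & forall k x y, D x -> D y ->
  (forall j, (j < k)%N -> lap_index (iter j g x) = lap_index (iter j g y)) ->
  `|x - y| <= q ^+ k.
Proof.
have [q q01 qb] : exists2 q : R, 0 <= q < 1 & forall i : 'I_M, beta i <= q.
  exists (\big[Num.max/0]_(i : 'I_M) beta i); last first.
    by move=> i; exact: le_bigmax.
  apply/andP; split; first exact: bigmax_ge_id.
  by apply/bigmax_ltP; split=> // i _; exact: (zz_expand Z).
exists q => //; elim=> [|k IH] x y Dx Dy xy.
  rewrite expr0; move: Dx Dy; rewrite /unit_itv/= !in_itv/=.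
  by move=> /andP[? ?] /andP[? ?]; rewrite ler_norml; apply/andP; split; lra.
have xy0 := xy 0%N isT; rewrite /= in xy0.
have xi := lap_index_itv Dx; have yi := lap_index_itv Dy; rewrite -xy0 in yi.
set i := lap_index x in xi yi.
have IHk : `|g x - g y| <= q ^+ k.
  apply: IH; [exact: set_fun_zigzag|exact: set_fun_zigzag|].
  by move=> j jk; rewrite -!iterSr; exact: xy.
have gxy : `|g x - g y| = (beta i)^-1 * `|x - y|.
  rewrite (zigzagE (ltn_ord i) xi) (zigzagE (ltn_ord i) yi) /lap_affine.
  rewrite opprD addrACA subrr add0r -mulrBr normrM lap_slope//.
  by congr (_ * `|_|); rewrite opprB addrA subrK.
have -> : `|x - y| = beta i * `|g x - g y|.
  by rewrite gxy mulrA divff ?mul1r// gt_eqF.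
by rewrite exprS ler_pM// ltW.
Qed.

End Zigzag.

(** * Separating the classes of a finite partition *)

Section Approximation.
Variable R : realType.
Local Notation lam := (@lebesgue_measure R).
Local Notation D := (@unit_itv R).

(** By compactness it suffices to find a positive distance that works near each point of
    [K], and [L] is closed. *)
Lemma compact_dist_gt0 (K L : set R) : compact K -> closed L -> K `&` L `<=` set0 ->
  exists2 e : R, 0 < e & forall x y, K x -> L y -> e <= `|x - y|.
Proof.
move=> /compact_near_coveringP cK cL KL.
have : \forall e \near (0 : R)^'+, K `<=` [set x | forall y, L y -> e <= `|x - y|].
  apply: cK => x Kx.
  have /nbhs_ballP[r /= r0 rL] : nbhs x (~` L).
    by apply: open_nbhs_nbhs; split; [exact: closed_openC|move=> Lx; apply: (KL x)].
  near=> x' e => /= y Ly.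
  have xx' : `|x - x'| < r / 2.
    by near: x'; apply: nbhsx_ballx; rewrite divr_gt0.
  have er : e <= r / 2.
    by near: e; apply: nbhs_right_le; rewrite divr_gt0.
  have xy : r <= `|x - y| by rewrite leNgt; apply/negP => h; exact: (rL y h Ly).
  have := ler_normD (x - x') (x' - y); rewrite addrA subrK; lra.
move=> h; have [e [e0 eK]] := @filter_ex _ (0 : R)^'+ _ _
  (filterI (nbhs_right_gt 0) h).
by exists e => // x y /eK; exact.
Unshelve. all: by end_near. Qed.

Lemma compact_family_separated m (V : 'I_m -> set R) :
  (forall i, compact (V i)) -> trivIset [set: 'I_m] V ->
  exists2 e : R, 0 < e &
    forall i j x y, V i x -> V j y -> `|x - y| < e -> i = j.
Proof.
move=> cV tV.
have /choice[d dP] : forall p : 'I_m * 'I_m, exists d : R, 0 < d /\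
    (p.1 != p.2 -> forall x y, V p.1 x -> V p.2 y -> d <= `|x - y|).
  move=> [i j] /=; have [->|ij] := eqVneq i j; first by exists 1.
  have [||d d0 dP] := @compact_dist_gt0 (V i) (V j) (cV i).
  - exact: compact_closed.
  - by move=> x Vx; move/eqP: ij; apply; apply: (tV i j) => //; exists x.
  - by exists d.
exists (\big[Num.min/1]_p d p).
  by apply/bigmin_gtP; split=> // p _; have [] := dP p.
move=> i j x y Vx Vy xy; apply/eqP; apply: contraT => ij.
have [_ /(_ ij x y Vx Vy) dij] := dP (i, j).
have : \big[Num.min/1]_p d p <= d (i, j) by exact: bigmin_le.
by move/le_trans/(_ dij); rewrite leNgt xy.
Qed.

(** By inner regularity, each class of the partition is a compact set up to a set of
    small measure, and disjoint compact sets are at positive distance.  The exceptional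
    set [E] is what remains of [0, 1] outside these compact sets. *)
Lemma nearby_points_same_label (m : nat) (X : R -> 'I_m) (eta : R) :
  simple_on D X -> 0 < eta ->
  exists2 e : R, 0 < e & exists E : set R,
    [/\ measurable E, E `<=` D, fine (lam E) <= eta &
        forall x y, (D `\` E) x -> (D `\` E) y -> `|x - y| < e -> X x = X y].
Proof.
move=> sX eta0.
have m0 : (0 < m)%N by exact: leq_ltn_trans (ltn_ord (X 0)).
have em0 : 0 < eta / m%:R by rewrite divr_gt0 ?ltr0n.
have lamD : lam D = 1%E by exact: lebesgue_unit_itv.
have lamfin A : measurable A -> A `<=` D -> (lam A < +oo)%E.
  move=> mA AD; apply: le_lt_trans (ltry 1); rewrite -lamD.
  by apply: le_measure; rewrite ?inE//; exact: measurable_itv.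
have /choice[V VP] : forall i, exists V : set R, [/\ compact V,
    V `<=` D `&` X @^-1` [set i] &
    (lam ((D `&` X @^-1` [set i]) `\` V) < (eta / m%:R)%:E)%E].
  move=> i; apply: lebesgue_regularity_inner => //.
  by apply: lamfin; [exact: (sX i)|exact: subIsetl].
have [e e0 eP] : exists2 e : R, 0 < e &
    forall i j x y, V i x -> V j y -> `|x - y| < e -> i = j.
  apply: compact_family_separated => [i|i j _ _ [x [Vi Vj]]].
    by have [] := VP i.
  have [_ /(_ x Vi) [_ <-] _] := VP i.
  by have [_ /(_ x Vj) [_ <-] _] := VP j.
have mV i : measurable (V i).
  by apply: closed_measurable; apply: compact_closed => //; have [] := VP i.
pose W i := (D `&` X @^-1` [set i]) `\` V i.
have mW i : measurable (W i) by apply: measurableD => //; exact: (sX i).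
exists e => //; exists (\big[setU/set0]_(i < m) W i); split.
- by apply: bigsetU_measurable.
- by rewrite -bigcup_pred => x [i _ [[]]].
- rewrite measure_bigsetU_ord//; last first.
    by move=> i j _ _ [x [[[_ <-] _] [[_ <-] _]]].
  have WE i : lam (W i) = (fine (lam (W i)))%:E.
    by rewrite fineK// ge0_fin_numE// lamfin// => x [[]].
  rewrite (eq_bigr (fun i => (fine (lam (W i)))%:E)); last by move=> i _; exact: WE.
  rewrite sumEFin/=.
  have -> : eta = \sum_(i < m) (eta / m%:R).
    by rewrite sumr_const card_ord -[RHS]mulr_natr mulfVK// pnatr_eq0 -lt0n.
  apply: ler_sum => i _; rewrite -lee_fin -WE ltW//.
  by have [] := VP i.
- move=> x y [Dx nEx] [Dy nEy] xy.
  have EV z : D z -> ~ (\big[setU/set0]_(i < m) W i) z -> V (X z) z.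
    move=> Dz nE; apply: contrapT => nV; apply: nE.
    by rewrite -bigcup_pred; exists (X z).
  exact: (eP _ _ x y (EV x Dx nEx) (EV y Dy nEy)).
Qed.

End Approximation.

(** * Zigzag maps are Markov, and their entropy *)

Section ZigzagPAM.
Variable R : realType.
Local Notation lam := (@lebesgue_measure R).
Local Notation D := (@unit_itv R).
Variables (N M : nat) (ell : nat -> R) (u c : nat -> nat).
Hypotheses (N0 : (0 < N)%N) (Z : markov_zigzag N M ell u c).
Local Notation t := (node ell).
Local Notation g := (zigzag N M ell u).

Let N0R : 0 < N%:R :> R. Proof. by rewrite ltr0n. Qed.

Lemma simple_lap_index : simple_on D (lap_index Z).
Proof. by move=> i; exact: measurable_fiber. Qed.

Lemma law_lap_index i : law lam D (lap_index Z) i = ell i.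
Proof.
have mI : measurable (`[t i, t i.+1] `&` [set: R]).
  by rewrite setIT; exact: measurable_itv.
have [_] := fiber_measure N0 Z mI; rewrite !setIT => h.
rewrite -[LHS]/(fine (lam (fiber Z i))) h lebesgue_measure_itv/= lte_fin.
by rewrite (node_ltS Z)// -EFinD/= nodeS addrAC subrr add0r.
Qed.

Lemma law_itinerary n (w : {ffun 'I_n -> 'I_M}) :
  exists2 v : nat -> 'I_M, (forall k : 'I_n, v k = w k) &
    (law lam D (itinerary g (lap_index Z) n) w)%:E = lam (cylinder Z n v).
Proof.
pose v (k : nat) := if insub k is Some k' then w k' else Ordinal (lap_count_gt0 Z).
exists v; first by move=> k; rewrite /v valK.
have -> : cylinder Z n v = D `&` itinerary g (lap_index Z) n @^-1` [set w].
  apply/seteqP; split=> x [Dx] h; split=> //.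
    by apply/ffunP => k; rewrite ffunE h// /v valK.
  by move=> k kn; rewrite /v insubT/= -h ffunE.
have mD : measurable (D : set (measurableTypeR R)) by exact: measurable_itv.
apply: (lawE (mu := lam) mD (lebesgue_unit_itv R)).
exact: (simple_itinerary (mu := lam) mD (set_fun_zigzag N0 Z) (zigzag_preserves N0 Z) (n := n) simple_lap_index).
Qed.

(** Points with the same long itinerary are close to each other, hence have the same
    label unless one of them is exceptional. *)
Lemma zigzag_generating m (X : R -> 'I_m) (eta : R) : simple_on D X -> 0 < eta ->
  exists k (phi : {ffun 'I_k -> 'I_M} -> 'I_m),
    law lam D (fun x => X x != phi (itinerary g (lap_index Z) k x)) true <= eta.
Proof.
move=> sX eta0; have [e e0 [E [mE ED lE XE]]] := nearby_points_same_label sX eta0.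
have [q /andP[q0 q1] qk] := lap_itinerary_contracts N0 Z.
have [k ke] : exists k, q ^+ k < e.
  have : \forall k \near \oo, q ^+ k < e.
    have := @cvg_expr R q; rewrite ger0_norm// => /(_ q1)/cvgrPdist_lt/(_ e e0).
    by apply: filterS => k; rewrite sub0r normrN ger0_norm ?exprn_ge0.
  by move=> [k _ /(_ k (leqnn k))]; exists k.
pose it := itinerary g (lap_index Z) k.
have /choice[phi phiP] : forall w, exists i, forall x, (D `\` E) x -> it x = w -> X x = i.
  move=> w; have [[y [Ey yw]]|h] := pselect (exists y, (D `\` E) y /\ it y = w).
    exists (X y) => x Ex xw; apply: XE => //; apply: le_lt_trans ke.
    have [[Dx _] [Dy _]] := (Ex, Ey); apply: qk => // j jk.
    have /ffunP/(_ (Ordinal jk)) : it x = it y by rewrite xw.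
    by rewrite !ffunE.
  by exists (X 0) => x Ex xw; case: h; exists x.
exists k, phi; apply: le_trans lE; rewrite /law.
have mD : measurable (D : set (measurableTypeR R)) by exact: measurable_itv.
have sit := simple_itinerary (mu := lam) mD (set_fun_zigzag N0 Z)
  (zigzag_preserves N0 Z) (n := k) simple_lap_index.
have sXi := simple_image (mu := lam) mD (lebesgue_unit_itv R)
  (phi := fun z => z.1 != phi z.2) (simple_pair sX sit) (fun x _ => erefl).
have lfin A : measurable A -> A `<=` D -> lam A \is a fin_num.
  move=> mA AD; rewrite ge0_fin_numE//; apply: le_lt_trans (ltry 1).
  rewrite -(lebesgue_unit_itv R).
  by apply: le_measure; rewrite ?inE//; exact: measurable_itv.
rewrite fine_le ?lfin//; first exact: (sXi true).
apply: le_measure; rewrite ?inE//.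
move=> x [Dx /= Xx]; apply: contrapT => nE.
by move: Xx; rewrite (phiP (it x) x)// eqxx.
Qed.

Lemma zigzag_entropy :
  lambda_entropy g = (\sum_(i < M) ell i * - ln (N%:R * ell i))%:E.
Proof.
have mD : measurable D by exact: measurable_itv.
have b0 (i : 'I_M) : 0 < N%:R * ell i by rewrite mulr_gt0// (zz_gt0 Z).
rewrite /lambda_entropy.
rewrite (@KS_entropy_code _ _ R lam D mD (lebesgue_unit_itv R) g
  (set_fun_zigzag N0 Z) (zigzag_preserves N0 Z) M (lap_index Z)
  (fun i => N%:R * ell i) (ln N%:R) simple_lap_index b0).
- by congr EFin; apply: eq_bigr => i _; rewrite law_lap_index.
- move=> n w; have [v vw lawE] := law_itinerary w.
  rewrite -lee_fin lawE; apply: le_trans (cylinder_measure_le N0 Z n v) _.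
  by rewrite lee_fin; apply: ler_prod => k _; rewrite vw lexx ltW.
- move=> n w; have [v vw lawE] := law_itinerary w.
  have := cylinder_measure_ge N0 Z n v; rewrite -lawE => -[[->]|h]; [by left|right].
  rewrite -lee_fin; apply: le_trans h; rewrite lee_fin expRN lnK ?posrE//.
  by rewrite ler_wpM2l ?invr_ge0//; apply: ler_prod => k _; rewrite vw lexx ltW.
- by move=> m X eta sX eta0; exact: zigzag_generating.
- move=> i; have Di : D (t i).
    apply: (node_itv Z (ltn_ord i)).
    by rewrite /= in_itv/= lexx ltW// (node_ltS Z).
  exists (t i) => //; apply: lap_indexE => //; split=> //; left.
  exact: (node_ltS Z).
Qed.

(** The grid is finite and invariant. *)
Lemma grid_eventually_periodic k : (k <= N)%N -> eventually_periodic g (k%:R / N%:R).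
Proof.
move=> kN.
have /choice[s sP] : forall k : 'I_N.+1, exists l : 'I_N.+1,
    g (k%:R / N%:R) = l%:R / N%:R.
  move=> l; have [i iM <-] := zz_grid Z (ltn_ord l : (l <= N)%N).
  have uN : (u i < N.+1)%N by rewrite ltnS (zz_bound Z).
  by exists (Ordinal uN); rewrite (zigzag_node N0 Z).
have sI j (l : 'I_N.+1) : iter j g (l%:R / N%:R) = (iter j s l)%:R / N%:R.
  by elim: j => //= j ->; rewrite sP.
pose k' : 'I_N.+1 := Ordinal (kN : (k < N.+1)%N).
have /trajectP[i io E] := looping_order s k'.
exists i, (order s k' - i)%N; rewrite subn_gt0; split=> //.
by rewrite subnKC 1?ltnW// -[k]/(k' : nat) !sI E.
Qed.

Lemma eventually_periodic_pre (f : R -> R) x :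
  eventually_periodic f (f x) -> eventually_periodic f x.
Proof.
by move=> [k [p [p0 E]]]; exists k.+1, p; split=> //; rewrite addSn !iterSr.
Qed.

Lemma node_eventually_periodic i : (i <= M)%N -> eventually_periodic g (t i).
Proof.
move=> iM; apply: eventually_periodic_pre; rewrite (zigzag_node N0 Z)//.
exact: grid_eventually_periodic (zz_bound Z iM).
Qed.

Lemma zigzag_C_lambda : C_lambda g.
Proof.
split; first exact: (set_fun_zigzag N0 Z).
  exact/continuous_subspaceT/interpolation_continuous.
exact: (zigzag_preserves N0 Z).
Qed.

(** The derivative is continuous inside the laps, and the end points of laps are mapped
    to the grid. *)
Lemma zigzag_PAM : PAM_lambda g.
Proof.
have M0 := lap_count_gt0 Z.
split; [split; first exact: zigzag_C_lambda|split].
- pose s := mkseq (fun i => t i.+1) M.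
  have sE i : (i <= M)%N -> nth 0 (0 :: s) i = t i.
    by case: i => [|i] iM; rewrite /= ?node0// nth_mkseq.
  exists s; rewrite ?size_mkseq.
    split; first by apply/(pathP 0) => i; rewrite size_mkseq => iM;
      rewrite sE 1?ltnW// nth_mkseq// (node_ltS Z).
    by rewrite (last_nth 0) size_mkseq sE// (zz_sum Z).
  move=> i iM; rewrite sE 1?ltnW// nth_mkseq//.
  set a := ((u i.+1)%:R - (u i)%:R) / (N%:R * ell i).
  exists a, ((u i)%:R / N%:R - a * t i) => x /=; rewrite in_itv/= => xi.
  by rewrite (zigzagE N0 Z iM xi) /lap_affine -/a; ring.
- move=> x [/andP[x0 x1] nd].
  have [|i iM /andP[ix xi]] := find_lap (x := x) Z; first by rewrite /unit_itv/= in_itv/= !ltW.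
  move: ix; rewrite le_eqVlt => /predU1P[<-|ix].
    by apply: node_eventually_periodic; exact: ltnW.
  move: xi; rewrite le_eqVlt => /predU1P[->|xi].
    exact: node_eventually_periodic.
  exfalso; apply: nd.
  set a := ((u i.+1)%:R - (u i)%:R) / (N%:R * ell i).
  apply: (@affine_derive1_continuous _ _ a ((u i)%:R / N%:R - a * t i) (t i) (t i.+1)).
    by rewrite ix.
  move=> z /andP[iz zi]; rewrite (zigzagE N0 Z iM) ?(ltW iz) ?(ltW zi)//.
  by rewrite /lap_affine -/a; ring.
- by rewrite -(node0 ell); exact: node_eventually_periodic.
- by rewrite -(zz_sum Z); exact: node_eventually_periodic.
Qed.

End ZigzagPAM.

(** * Ranks of sampled values *)

Section Rank.
Variable R : realType.
Local Notation lam := (@lebesgue_measure R).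
Local Notation D := (@unit_itv R).

Lemma uniformly_continuous_unit_itv (f : R -> R) (w : R) :
  {within D, continuous f} -> 0 < w ->
  exists2 r : R, 0 < r & forall x y, D x -> D y -> `|x - y| <= r -> `|f x - f y| <= w.
Proof.
move=> /subspace_continuousP cf w0.
have : \forall r \near (0 : R)^'+,
    D `<=` [set x | forall y, D x -> D y -> `|x - y| <= r -> `|f x - f y| <= w].
  apply: (compact_near_coveringP _).1 (@segment_compact R 0 1) _ _ _ _ _ => x Dx.
  have /cvgrPdist_lt/(_ (w / 2)) := cf x Dx.
  rewrite divr_gt0// => /(_ isT)/nbhs_ballP[q /= q0 qf].
  have qf' z : `|x - z| < q -> D z -> `|f x - f z| < w / 2 by move=> xz; apply: qf.
  near=> x' r => /= y Dx' Dy xy.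
  have xx' : `|x - x'| < q / 2.
    by near: x'; apply: nbhsx_ballx; rewrite divr_gt0.
  have rq : r < q / 2.
    by near: r; apply: nbhs_right_lt; rewrite divr_gt0.
  have h1 : `|f x - f x'| < w / 2 by apply: qf' => //; lra.
  have h2 : `|f x - f y| < w / 2.
    apply: qf' => //; have := ler_normD (x - x') (x' - y).
    by rewrite addrA subrK; lra.
  have := ler_normD (f x' - f x) (f x - f y); rewrite addrA subrK (distrC (f x') (f x)); lra.
move=> h; have [r [r0 rK]] := @filter_ex _ (0 : R)^'+ _ _
  (filterI (nbhs_right_gt 0) h).
by exists r => // x y Dx Dy; exact: rK.
Unshelve. all: by end_near. Qed.

Variable N : nat.
Hypothesis N0 : (0 < N)%N.
Local Notation J := (@grid_cell R N).
Let N0R : 0 < N%:R :> R. Proof. by rewrite ltr0n. Qed.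

Lemma card_cells_le (B : {pred 'I_N}) (S : set R) : measurable S -> S `<=` D ->
  (forall k, B k -> J k `<=` S) -> ((#|B|%:R / N%:R)%:E <= lam S)%E.
Proof.
move=> mS SD BS; rewrite (lebesgue_split_cells N0 mS SD).
have -> : #|B|%:R / N%:R = \sum_(k : 'I_N) (if k \in B then N%:R^-1 else 0) :> R.
  by rewrite -big_mkcond/= sumr_const mulr_natl.
rewrite -sumEFin; apply: lee_sum => k _; case: ifPn => kB; last exact: measure_ge0.
by rewrite (setIidr (BS k kB)) (grid_cell_measure R N0).
Qed.

Variables (f : R -> R) (w : R).
Hypotheses (Cf : C_lambda f).
Hypothesis fw : forall x y, D x -> D y -> `|x - y| <= N%:R^-1 -> `|f x - f y| <= w.

Local Notation y a := (f (a%:R / N%:R)).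

Lemma cell_sub_unit_itv (k : nat) : (k < N)%N -> J k `<=` D.
Proof.
move=> kN x; rewrite /grid_cell /unit_itv/= !in_itv/= => /andP[x0 x1].
rewrite (le_trans _ x0) ?divr_ge0//= (le_trans x1)//.
by rewrite ler_pdivrMr// mul1r ler_nat.
Qed.

Lemma grid_unit_itv (k : nat) : (k <= N)%N -> D (k%:R / N%:R).
Proof.
move=> kN; rewrite /unit_itv/= in_itv/= divr_ge0//=.
by rewrite ler_pdivrMr// mul1r ler_nat.
Qed.

Lemma cell_oscillation (k : nat) x : (k < N)%N -> J k x -> `|f x - y k| <= w.
Proof.
move=> kN Jx; apply: fw; [exact: (cell_sub_unit_itv kN)|exact/grid_unit_itv/ltnW|].
move: Jx; rewrite /grid_cell/= in_itv/= => /andP[x0 x1].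
rewrite ger0_norm ?subr_ge0// lerBlDl (le_trans x1)//.
by rewrite -natr1 mulrDl mul1r.
Qed.

(** The cells of [B] lie in the preimage of [[0, z + w]], and this preimage has measure
    at most [z + w] because [f] preserves Lebesgue measure. *)
Lemma count_le (B : {pred 'I_N}) (z : R) : 0 <= z + w ->
  (forall k, B k -> y k <= z) -> #|B|%:R / N%:R <= z + w.
Proof.
have [fD _ mpf] := Cf.
move=> zw0 Bz.
have s : `[0, Num.min 1 (z + w)]%classic `<=` D.
  by move=> x; rewrite /unit_itv/= !in_itv/= le_min => /andP[-> /andP[-> _]].
have [m1 m2] := mpf _ (measurable_itv `[0, Num.min 1 (z + w)]) s.
rewrite -lee_fin; apply: le_trans (card_cells_le m1 (@subIsetl _ _ _) _) _.
  move=> k Bk x Jx; have Dx := cell_sub_unit_itv (ltn_ord k) Jx; split=> //.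
  have := fD x Dx; have := cell_oscillation (ltn_ord k) Jx; have := Bz k Bk.
  rewrite /unit_itv/= !in_itv/= le_min => yz /ler_normlP[_ h] /andP[-> ->] /=.
  by lra.
rewrite m2 lebesgue_measure_itv/= lte_fin oppr0 adde0; case: ifP => _.
  by rewrite lee_fin ge_min lexx orbT.
by rewrite lee_fin.
Qed.

Lemma count_ge (B : {pred 'I_N}) (z : R) : z - w <= 1 ->
  (forall k, B k -> z <= y k) -> #|B|%:R / N%:R <= 1 - (z - w).
Proof.
have [fD _ mpf] := Cf.
move=> zw0 Bz.
have s : `[Num.max 0 (z - w), 1]%classic `<=` D.
  by move=> x; rewrite /unit_itv/= !in_itv/= ge_max => /andP[/andP[-> _] ->].
have [m1 m2] := mpf _ (measurable_itv `[Num.max 0 (z - w), 1]) s.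
rewrite -lee_fin; apply: le_trans (card_cells_le m1 (@subIsetl _ _ _) _) _.
  move=> k Bk x Jx; have Dx := cell_sub_unit_itv (ltn_ord k) Jx; split=> //.
  have := fD x Dx; have := cell_oscillation (ltn_ord k) Jx; have := Bz k Bk.
  rewrite /unit_itv/= !in_itv/= ge_max => yz /ler_normlP[h _] /andP[-> ->] /=.
  by rewrite andbT; lra.
rewrite m2 lebesgue_measure_itv/= lte_fin; case: ifP => _.
  by rewrite -EFinD lee_fin lerD2l lerN2 le_max lexx orbT.
by rewrite lee_fin subr_ge0.
Qed.

(* Ties are broken by position, to make the rank injective. *)
Let prec (b a : 'I_N) : bool := (y b < y a) || ((y b == y a) && (b < a)%N).

(** The cells that precede [a] have values at most [y a] and the others have values at
    least [y a]; [count_le] and [count_ge] bound the two numbers of cells, whose sum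
    is [N]. *)
Lemma rank_permutation : exists pi : 'I_N -> 'I_N, injective pi /\
  forall a, `|(pi a)%:R / N%:R - y a| <= w.
Proof.
have [fD _ _] := Cf.
have precI a : prec a a = false by rewrite /prec ltxx eqxx ltnn.
have precT a b d : prec a b -> prec b d -> prec a d.
  rewrite /prec => /orP[ab|/andP[/eqP-> ab]] /orP[bd|/andP[/eqP<- bd]].
  - by rewrite (lt_trans ab bd).
  - by rewrite ab.
  - by rewrite bd.
  - by rewrite eqxx (ltn_trans ab bd) orbT.
have rk a : (#|[pred b | prec b a]| < N)%N.
  rewrite -[N in (_ < N)%N]card_ord; apply: proper_card.
  apply/properP; split; first exact: subset_predT.
  by exists a => //; rewrite inE precI.
have rkS a b : prec a b -> (#|[pred d | prec d a]| < #|[pred d | prec d b]|)%N.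
  move=> ab; apply: proper_card; apply/properP; split.
    by apply/fintype.subsetP => d; rewrite !inE => /precT; exact.
  by exists a; rewrite !inE ?precI.
exists (fun a => Ordinal (rk a)); split.
  move=> a b [] E; apply/eqP; apply: contraT => ab.
  have : prec a b || prec b a.
    rewrite /prec; have [//|//|yab] /= := ltgtP (y a) (y b).
    by rewrite -neq_ltn.
  by case/orP => /rkS; rewrite E ltnn.
move=> a /=; have Da : D (a%:R / N%:R) by apply/grid_unit_itv/ltnW.
have w0 : 0 <= w by apply: le_trans (fw Da Da _); rewrite ?subrr ?normr0 ?invr_ge0.
have := fD _ Da; rewrite /unit_itv/= in_itv/= => /andP[y0 y1].
have up : #|[pred b | prec b a]|%:R / N%:R <= y a + w.
  apply: count_le; first by rewrite addr_ge0.
  by move=> b /orP[/ltW//|/andP[/eqP->]].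
have lo : #|[pred b | ~~ prec b a]|%:R / N%:R <= 1 - (y a - w).
  apply: count_ge; first by lra.
  by move=> b; rewrite /= negb_or -leNgt => /andP[].
have cC : (#|[pred b | prec b a]| + #|[pred b | ~~ prec b a]| = N)%N.
  by rewrite -[RHS]card_ord -(cardC [pred b | prec b a]).
have : #|[pred b | prec b a]|%:R / N%:R + #|[pred b | ~~ prec b a]|%:R / N%:R = 1 :> R.
  by rewrite -mulrDl -natrD cC divff// gt_eqF.
by move=> h; rewrite ler_norml; apply/andP; split; lra.
Qed.
End Rank.

(** * Walks of prescribed length *)

Section Walks.
Local Open Scope nat_scope.

Definition edge_count (m : nat) (U : nat -> nat) (k : nat) : nat :=
  \sum_(i < m) (edge U i == k).

(** The multiplicity [C] will make all relative lap lengths small, hence the entropy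
    large. *)
Record walk (lo hi m p q : nat) (C : nat) (U : nat -> nat) : Prop := Walk {
  walk_start : U 0 = p;
  walk_end : U m = q;
  walk_adj : forall i, i < m -> U i.+1 = (U i).+1 \/ U i = (U i.+1).+1;
  walk_range : forall i, i <= m -> lo <= U i <= hi;
  walk_count : forall k, lo <= k < hi -> C <= edge_count m U k }.

Variables (lo hi : nat).

Lemma walk_cat m1 m2 p q s C1 C2 U1 U2 :
  walk lo hi m1 p q C1 U1 -> walk lo hi m2 q s C2 U2 ->
  exists U, walk lo hi (m1 + m2) p s (C1 + C2) U.
Proof.
move=> [a1 b1 c1 d1 e1] [a2 b2 c2 d2 e2].
pose U i := if i <= m1 then U1 i else U2 (i - m1).
have UL i : i <= m1 -> U i = U1 i by rewrite /U => ->.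
have UR i : U (m1 + i) = U2 i.
  rewrite /U; case: i => [|i]; first by rewrite addn0 leqnn b1 a2.
  by rewrite ifF ?addKn//; lia.
have URS i : U (m1 + i).+1 = U2 i.+1 by rewrite -addnS UR.
exists U; split.
- by rewrite UL.
- by rewrite UR.
- move=> i im; have [im1|im1] := ltnP i m1; first by rewrite (UL i (ltnW im1)) (UL i.+1 im1); exact: c1.
  by rewrite -(subnKC im1) UR URS; apply: c2; rewrite ltn_subLR.
- move=> i im; have [im1|im1] := leqP i m1; first by rewrite UL ?d1.
  by rewrite -(subnKC (ltnW im1)) UR; apply: d2; rewrite leq_subLR.
- move=> k kI; rewrite /edge_count big_split_ord/=; apply: leq_add.
    apply: leq_trans (e1 k kI) _; apply: leq_sum => i _.
    by rewrite /edge (UL i (ltnW (ltn_ord i))) (UL i.+1 (ltn_ord i)).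
  apply: leq_trans (e2 k kI) _; apply: leq_sum => i _.
  by rewrite /edge UR URS.
Qed.

Lemma walk_up p q : lo <= p <= q -> q <= hi ->
  walk lo hi (q - p) p q 0 (fun i => p + i).
Proof.
move=> /andP[lp pq] qh; split=> //; first by rewrite addn0.
- by rewrite subnKC.
- by move=> i _; left; rewrite addnS.
- by move=> i im; lia.
Qed.

Lemma walk_down p q : lo <= q <= p -> p <= hi ->
  walk lo hi (p - q) p q 0 (fun i => p - i).
Proof.
move=> /andP[lq qp] ph; split=> //; first by rewrite subn0.
- by lia.
- by move=> i im; right; lia.
- by move=> i im; lia.
Qed.

Lemma walk_sweep : lo <= hi -> walk lo hi (hi - lo) lo hi 1 (fun i => lo + i).
Proof.
move=> lh; have [a b c d _] := walk_up (q := hi) (p := lo) (introT andP (conj (leqnn lo) lh)) (leqnn hi).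
split=> // k /andP[lk kh].
have kl : k - lo < hi - lo by rewrite ltn_sub2r// (leq_ltn_trans lk).
rewrite /edge_count (bigD1 (Ordinal kl))//= /edge subnKC// addnS subnKC//.
by rewrite (minn_idPl (leqnSn k)) eqxx.
Qed.

Lemma walk_iter m p C U n : walk lo hi m p p C U ->
  exists U', walk lo hi (n * m) p p (n * C) U'.
Proof.
move=> wU; elim: n => [|n [U' wU']].
  have [a _ _ d _] := wU.
  by exists (fun=> p); split=> // i _; rewrite -a; exact: d.
by rewrite !mulSn; exact: walk_cat wU wU'.
Qed.

(** Go down to [lo], sweep the whole interval back and forth [C] times, waste the
    remaining time on the first edge, and go up to [q].  The time to waste is even
    because [p], [q] and [m] are. *)
Lemma walk_exists (p q C m : nat) : lo < hi -> lo <= p <= hi -> lo <= q <= hi ->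
  ~~ odd p -> ~~ odd q -> ~~ odd m -> C.+1 * (hi - lo) * 2 <= m ->
  exists U, walk lo hi m p q C U.
Proof.
move=> lh /andP[lp ph] /andP[lq qh] op oq om mC.
have w1 := walk_down (introT andP (conj (leqnn lo) lp)) ph.
have w4 := walk_up (introT andP (conj (leqnn lo) lq)) qh.
have [U2 w2] := walk_iter C (projT2 (cid (walk_cat (walk_sweep (ltnW lh))
  (walk_down (introT andP (conj (leqnn lo) (ltnW lh))) (leqnn hi))))).
have wp1 := walk_up (introT andP (conj (leqnn lo) (leqnSn lo))) lh.
have wp2 := walk_down (introT andP (conj (leqnn lo) (leqnSn lo))) lh.
pose total := (p - lo) + C * ((hi - lo) + (hi - lo)) + (q - lo).
have totE : total <= m by rewrite /total; nia.
have tot_even : ~~ odd (m - total).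
  rewrite oddB// (negbTE om)/= /total !oddD addnn oddM odd_double andbF addbF.
  by rewrite !oddB// (negbTE op) (negbTE oq)/= addbb.
have [U3 w3] := walk_iter ((m - total)./2) (projT2 (cid (walk_cat wp1 wp2))).
have [U12 w12] := walk_cat w1 w2.
have [U123 w123] := walk_cat w12 w3.
have [U [a b c d e]] := walk_cat w123 w4.
have mE : p - lo + C * (hi - lo + (hi - lo)) +
   (m - total)./2 * (lo.+1 - lo + (lo.+1 - lo)) + (q - lo) = m.
  rewrite subSnn muln2 even_halfK//.
  by rewrite /total in totE *; lia.
exists U; rewrite mE in b c d e; split=> // k kI.
by apply: leq_trans (e k kI) => /=; nia.
Qed.
End Walks.

(** * Gluing walks into a zigzag map *)

Section Assembly.
Variable R : realType.

(** The lap [j = a * m + i] is the [i]-th lap of cell [a]. *)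
Lemma sum_divmod (V : nmodType) (N m : nat) (F : nat -> nat -> V) :
  \sum_(j < N * m) F (j %/ m)%N (j %% m)%N = \sum_(a < N) \sum_(i < m) F a i.
Proof.
elim: N => [|N IH]; first by rewrite !big_ord0.
rewrite mulSn addnC big_split_ord/= IH big_ord_recr/=; congr (_ + _).
apply: eq_bigr => i _; have m0 : (0 < m)%N by exact: leq_ltn_trans (ltn_ord i).
by rewrite divnMDl// modnMDl divn_small// modn_small// addn0.
Qed.

Variables (N m : nat) (U : nat -> nat -> nat) (W : nat -> nat -> R).
Hypotheses (N0 : (0 < N)%N) (m0 : (0 < m)%N).
(* [U a] is the walk of cell [a], and [W a i] is the length of its [i]-th lap relative
   to the length of the cell. *)
Hypothesis U_match : forall a, (a < N)%N -> U a m = U a.+1 0%N.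
Hypothesis U_adj : forall a i, (a < N)%N -> (i < m)%N ->
  U a i.+1 = (U a i).+1 \/ U a i = (U a i.+1).+1.
Hypothesis U_bound : forall a i, (a < N)%N -> (i <= m)%N -> (U a i <= N)%N.
Hypothesis W_gt0 : forall a i, (a < N)%N -> (i < m)%N -> 0 < W a i.
Hypothesis W_lt1 : forall a i, (a < N)%N -> (i < m)%N -> W a i < 1.
Hypothesis W_row : forall a, (a < N)%N -> \sum_(i < m) W a i = 1.
Hypothesis W_col : forall k, (k < N)%N ->
  \sum_(a < N) \sum_(i < m | edge (U a) i == k) W a i = 1.

Definition glue_ell (j : nat) : R := W (j %/ m)%N (j %% m)%N / N%:R.
Definition glue_u (j : nat) : nat := U (j %/ m)%N (j %% m)%N.

Let N0R : 0 < N%:R :> R. Proof. by rewrite ltr0n. Qed.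

Lemma glue_uE a i : (a < N)%N -> (i <= m)%N -> glue_u (a * m + i) = U a i.
Proof.
move=> aN; rewrite leq_eqVlt => /predU1P[->|im]; rewrite /glue_u.
  by rewrite -mulSnr mulnK// modnMl -U_match.
by rewrite divnMDl// modnMDl divn_small// modn_small// addn0.
Qed.

Lemma glue_index j : (j < N * m)%N ->
  [/\ (j %/ m < N)%N, (j %% m < m)%N & j = (j %/ m * m + j %% m)%N].
Proof. by move=> jN; rewrite ltn_divLR// ltn_pmod// -divn_eq. Qed.

Lemma glue_edge j : (j < N * m)%N -> edge glue_u j = edge (U (j %/ m)) (j %% m).
Proof.
move=> /glue_index[aN im jE]; rewrite /edge {1 2}jE -addnS.
by rewrite !glue_uE// ltnW.
Qed.

Lemma glue_node a i : (a < N)%N -> (i <= m)%N ->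
  node glue_ell (a * m + i) = (a%:R + \sum_(i' < i) W a i') / N%:R.
Proof.
move=> aN im; rewrite /node big_split_ord/= mulrDl; congr (_ + _).
  rewrite /glue_ell -mulr_suml; congr (_ / _).
  rewrite (sum_divmod a m (fun a i => W a i)) (eq_bigr (fun=> 1)).
    by rewrite sumr_const card_ord.
  by move=> b _; rewrite W_row// (ltn_trans (ltn_ord b)).
rewrite mulr_suml; apply: eq_bigr => k _.
have km : (k < m)%N by exact: leq_trans (ltn_ord k) im.
by rewrite /glue_ell divnMDl// modnMDl divn_small// modn_small// addn0.
Qed.

Lemma glue_node_grid a : (a <= N)%N -> node glue_ell (a * m) = a%:R / N%:R.
Proof.
case: a => [|a] aN; first by rewrite /node big_ord0 mul0r.
by rewrite mulSnr glue_node// W_row// natr1.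
Qed.

Lemma partial_row_itv a i : (a < N)%N -> (i <= m)%N -> 0 <= \sum_(i' < i) W a i' <= 1.
Proof.
move=> aN im; rewrite sumr_ge0/= => [|k _]; last first.
  by rewrite ltW// W_gt0// (leq_trans (ltn_ord k)).
rewrite -(W_row aN) -(subnKC im) big_split_ord/= lerDl sumr_ge0// => k _.
by rewrite ltW// W_gt0// -ltn_subRL.
Qed.

Lemma glue_zigzag : markov_zigzag N (N * m) glue_ell glue_u (fun j => j %/ m)%N.
Proof.
split.
- by move=> j /glue_index[aN im _]; rewrite /glue_ell divr_gt0// W_gt0.
- by rewrite glue_node_grid// divff ?gt_eqF.
- move=> j /glue_index[aN im jE].
  have -> : glue_u j = U (j %/ m) (j %% m) by [].
  have -> : glue_u j.+1 = U (j %/ m) (j %% m).+1 by rewrite {1}jE -addnS glue_uE.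
  exact: U_adj.
- move=> j; rewrite leq_eqVlt => /predU1P[->|/glue_index[aN im jE]]; last first.
    by rewrite /glue_u U_bound// ltnW.
  rewrite -(prednK N0) mulSnr glue_uE ?prednK// U_bound//.
  by rewrite prednK.
- move=> j /glue_index[aN im jE]; rewrite {2 3}jE -addnS !glue_node// 1?ltnW//.
  have /andP[h1 _] := partial_row_itv aN (ltnW im).
  have /andP[_ h2] := partial_row_itv aN im.
  by rewrite !ler_pM2r ?invr_gt0// lerDl -natr1 lerD2l.
- move=> k kN; exists (k * m)%N; first by rewrite leq_pmul2r.
  exact: glue_node_grid.
- move=> k kN; rewrite (eq_bigl (fun j : 'I_(N * m) => edge (U (j %/ m)) (j %% m) == k)).
    rewrite /glue_ell -mulr_suml big_mkcond/=.
    rewrite (sum_divmod N m (fun a i => if edge (U a) i == k then W a i else 0)).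
    under eq_bigr do rewrite -big_mkcond.
    by rewrite (W_col kN) mul1r.
  by move=> j; rewrite glue_edge.
- move=> j /glue_index[aN im _]; rewrite /glue_ell mulrCA divff ?mulr1 ?W_lt1//.
  by rewrite gt_eqF.
Qed.

Lemma glue_entropy :
  \sum_(j < N * m) glue_ell j * - ln (N%:R * glue_ell j) =
  N%:R^-1 * \sum_(a < N) \sum_(i < m) W a i * - ln (W a i).
Proof.
rewrite -(sum_divmod N m (fun a i => W a i * - ln (W a i))) mulr_sumr.
apply: eq_bigr => j _; rewrite /glue_ell mulrCA divff ?mulr1 ?gt_eqF//.
by rewrite mulrAC mulrC.
Qed.

Lemma glue_range x : unit_itv x -> exists a i, [/\ (a < N)%N, (i < m)%N,
  a%:R / N%:R <= x <= a.+1%:R / N%:R &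
  (edge (U a) i)%:R / N%:R <= zigzag N (N * m) glue_ell glue_u x <=
  (edge (U a) i).+1%:R / N%:R].
Proof.
move=> Dx; have [j jN jx] := find_lap glue_zigzag Dx.
have [aN im jE] := glue_index jN.
exists (j %/ m)%N, (j %% m)%N; split=> //.
  have [h1 h2] := zz_cell glue_zigzag jN; have /andP[h3 h4] := jx.
  by rewrite (le_trans h1 h3) (le_trans h4 h2).
by rewrite (zigzagE N0 glue_zigzag jN jx) -glue_edge// -(lap_affine_itv N0 glue_zigzag).
Qed.
End Assembly.

(** * Tuning the entropy of a family of weights *)

Section EntropyFamily.
Variable R : realType.

Lemma neg_xlnx_le_sub (x : R) : 0 < x -> x * - ln x <= 1 - x.
Proof.
move=> x0; have h := @ln_le_sub1 R x^-1; rewrite lnV ?posrE// invr_gt0 in h.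
have := h x0; rewrite -(ler_pM2l x0) mulrBr divff ?gt_eqF// mulr1; lra.
Qed.

Lemma neg_xlnx_le_sqrt (x : R) : 0 < x -> x * - ln x <= 2 * Num.sqrt x.
Proof.
move=> x0; set q := Num.sqrt x.
have q0 : 0 < q by rewrite sqrtr_gt0.
have xE : x = q ^+ 2 by rewrite sqr_sqrtr// ltW.
have h := neg_xlnx_le_sub q0; rewrite xE lnXn// -mulNrn -mulr_natr expr2.
have : q * (q * - ln q) <= q * (1 - q) by rewrite ler_pM2l.
have : 0 <= q * q by rewrite mulr_ge0 ?ltW.
lra.
Qed.

Variables (I : finType) (b : I -> bool) (w : I -> R).
Hypotheses (w_gt0 : forall i, 0 < w i) (w_le1 : forall i, w i <= 1).

(** The segment from the degenerate weights [b] to the positive weights [w]. *)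
Definition mix (s : R) (i : I) : R := (1 - s) * (b i)%:R + s * w i.

Lemma mix_gt0 s i : 0 < s <= 1 -> 0 < mix s i.
Proof.
move=> /andP[s0 s1]; rewrite /mix ltr_wpDl ?mulr_gt0//.
by rewrite mulr_ge0 ?subr_ge0.
Qed.

(** A weight near 1 contributes at most [1 - x], a weight near 0 at most [2 sqrt x];
    with the parameter [z ^+ 2] both are at most [2 z]. *)
Lemma mix_entropy_small z i : 0 < z <= 1 ->
  mix (z ^+ 2) i * - ln (mix (z ^+ 2) i) <= 2 * z.
Proof.
move=> /andP[z0 z1]; have z2 : 0 < z ^+ 2 <= 1 by rewrite exprn_gt0// exprn_ile1// ltW.
have W0 := mix_gt0 i z2; move: W0; rewrite /mix; case: (b i).
  rewrite mulr1 => /neg_xlnx_le_sub/le_trans; apply.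
  have : z * z <= z * 1 by rewrite ler_pM2l.
  have := mulr_gt0 (andP z2).1 (w_gt0 i).
  rewrite expr2; lra.
rewrite mulr0 add0r => /neg_xlnx_le_sqrt/le_trans; apply.
rewrite ler_pM2l// -[leRHS](gtr0_norm z0) -sqrtr_sqr ler_wsqrtr//.
by rewrite ler_piMr// ltW// (andP z2).1.
Qed.

Definition mix_entropy (s : R) : R := \sum_i mix s i * - ln (mix s i).

Lemma continuous_sum (J : Type) (r : seq J) (F : J -> R -> R) (x : R) :
  (forall j, {for x, continuous (F j)}) ->
  {for x, continuous (fun y => \sum_(j <- r) F j y)}.
Proof.
move=> cF; elim: r => [|j r IH].
  rewrite (_ : (fun y => _) = cst 0); first exact: cvg_cst.
  by apply/funext => y; rewrite big_nil.
rewrite (_ : (fun y => _) = (fun y => F j y + \sum_(j <- r) F j y)).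
  exact: (@continuousD _ _ _ (F j) _ x (cF j) IH).
by apply/funext => y; rewrite big_cons.
Qed.

Lemma mix_continuous i : continuous (fun s => mix s i).
Proof.
move=> s; apply: cvgD.
  by apply: cvgMl; apply: cvgB; [exact: cvg_cst|exact: cvg_id].
by apply: cvgMl; exact: cvg_id.
Qed.

Lemma mix_entropy_continuous (s0 : R) : 0 < s0 ->
  {within `[s0, 1], continuous mix_entropy}.
Proof.
move=> s00; apply: continuous_in_subspaceT => s; rewrite inE/= in_itv/= => /andP[s0s s1].
apply: continuous_sum => i.
apply: cvgM; first exact: mix_continuous.
apply: cvgN; apply: (@cvg_comp _ _ _ (mix^~ i) (@ln R)).
  exact: mix_continuous.
by apply: continuous_ln; apply: mix_gt0; rewrite s1 (lt_le_trans s00).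
Qed.

(** Intermediate value theorem between a parameter with small entropy and 1. *)
Lemma mix_entropy_value (c : R) : 0 < c -> c <= mix_entropy 1 ->
  exists2 s, 0 < s <= 1 & mix_entropy s = c.
Proof.
move=> c0 c1.
pose z := Num.min 1 (c / (2 * #|I|.+1%:R)).
have z0 : 0 < z by rewrite lt_min ltr01 divr_gt0// mulr_gt0.
have z1 : z <= 1 by rewrite ge_min lexx.
have s01 : z ^+ 2 <= 1 by rewrite exprn_ile1// ltW.
have small : mix_entropy (z ^+ 2) <= c.
  apply: (@le_trans _ _ (\sum_(i : I) 2 * z)).
    by apply: ler_sum => i _; apply: mix_entropy_small; rewrite z0.
  rewrite sumr_const.
  apply: (@le_trans _ _ ((2 * z) *+ #|I|.+1)).
    by rewrite [leRHS]mulrSr lerDl mulr_ge0// ltW.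
  rewrite -[leLHS]mulr_natr.
  have : z <= c / (2 * #|I|.+1%:R) by rewrite ge_min lexx orbT.
  by rewrite ler_pdivlMr ?mulr_gt0//; lra.
have [] := @IVT R mix_entropy (z ^+ 2) 1 c s01.
- exact/mix_entropy_continuous/exprn_gt0.
- by rewrite ge_min small/= le_max c1 orbT.
move=> s; rewrite in_itv/= => /andP[zs s1] <-; exists s => //.
by rewrite s1 andbT (lt_le_trans _ zs)// exprn_gt0.
Qed.

End EntropyFamily.

(** * Laps and weights near a permutation *)

Section Band.
Variables (R : realType) (N r : nat).
Hypothesis N0 : (0 < N)%N.

Definition near_cells (i k : nat) : bool := (i <= k + r)%N && (k <= i + r)%N.

(** A symmetric doubly stochastic matrix, positive exactly at distance at most [r] from
    the diagonal: entries [1/N] in the band, and the missing mass of each row on the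
    diagonal. *)
Definition band (i k : nat) : R :=
  (near_cells i k)%:R / N%:R +
  (i == k)%:R * (1 - (\sum_(l < N) (near_cells i l)%:R) / N%:R).

Let N0R : 0 < N%:R :> R. Proof. by rewrite ltr0n. Qed.

Lemma band_diag_ge0 (i : nat) : 0 <= 1 - (\sum_(l < N) (near_cells i l)%:R) / N%:R :> R.
Proof.
rewrite subr_ge0 ler_pdivrMr// mul1r -[N in leRHS]card_ord -sum1_card natr_sum.
by apply: ler_sum => l _; rewrite ler_nat leq_b1.
Qed.

Lemma band_gt0 i k : near_cells i k -> 0 < band i k.
Proof.
move=> ik; rewrite /band ik ltr_pwDl ?divr_gt0//.
by rewrite mulr_ge0// band_diag_ge0.
Qed.

Lemma band_far i k : ~~ near_cells i k -> band i k = 0.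
Proof.
move=> ik; rewrite /band (negbTE ik) mul0r add0r.
by case: eqVneq ik => [->|_ _]; rewrite ?mul0r// /near_cells leq_addr.
Qed.

Lemma band_ge0 i k : 0 <= band i k.
Proof.
by have [/band_gt0/ltW//|/band_far->] := boolP (near_cells i k).
Qed.

Lemma band_sym i k : band i k = band k i.
Proof.
rewrite /band [near_cells i k]andbC; congr (_ + _).
by rewrite eq_sym; case: eqVneq => [->//|_]; rewrite !mul0r.
Qed.

Lemma sum_band i : (i < N)%N -> \sum_(k < N) band i k = 1.
Proof.
move=> iN; rewrite big_split/= -mulr_suml -mulr_suml.
suff -> : \sum_(k < N) (i == k)%:R = 1 :> R by rewrite mul1r subrKC.
rewrite (bigD1 (Ordinal iN))//= eqxx big1 ?addr0//.
by move=> k ki; rewrite eq_sym -[(k : nat) == i]/(k == Ordinal iN) (negbTE ki).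
Qed.

Lemma band_le1 i k : (i < N)%N -> (k < N)%N -> band i k <= 1.
Proof.
move=> iN kN; rewrite -(sum_band iN) (bigD1 (Ordinal kN))//= lerDl.
by apply: sumr_ge0 => *; exact: band_ge0.
Qed.
End Band.

Lemma walk_edge lo hi m p q C U i : walk lo hi m p q C U -> (i < m)%N ->
  (lo <= edge U i < hi)%N.
Proof.
move=> [_ _ adj rg _] im; rewrite /edge.
have /andP[h1 h2] := rg i (ltnW im); have /andP[h3 h4] := rg i.+1 im.
by case: (adj i im) => h; move: h1 h2 h3 h4; rewrite h; lia.
Qed.

Section Windows.
Variables (N r C m : nat) (pi : 'I_N -> 'I_N).

Definition target (a : nat) : nat := if insub a is Some a' then val (pi a') else 0%N.

Lemma targetE (a : 'I_N) : target a = pi a.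
Proof. by rewrite /target valK. Qed.

Lemma target_lt a : (a < N)%N -> (target a < N)%N.
Proof. by move=> aN; rewrite -[a]/(val (Ordinal aN)) targetE. Qed.

(** The walk of cell [a] starts at the largest even vertex up to [pi a].  Evenness
    allows all cells to have the same number of laps; the minimum with [N.-1] makes the
    last walk return to its starting point. *)
Definition base_vertex (a : nat) : nat := (target (minn a N.-1))./2.*2.

Definition window a U : Prop := walk (target a - r) (minn N (target a + r.+1)) m
  (base_vertex a) (base_vertex a.+1) C U.

Section WalkExists.
Hypothesis r0 : (0 < r)%N.
Hypothesis pi_jump : forall a b : 'I_N, b = a.+1 :> nat ->
  (pi b < pi a + r)%N && (pi a < pi b + r)%N.
Hypotheses (m_even : ~~ odd m) (m_large : (C.+1 * r.*2.+1 * 2 <= m)%N).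

Lemma window_walk_exists a : (a < N)%N -> exists U, window a U.
Proof.
move=> aN; have tN := target_lt aN.
have aE : minn a N.-1 = a by lia.
have v1 : (target a - r <= base_vertex a <= minn N (target a + r.+1))%N.
  by rewrite /base_vertex aE; have := odd_double_half (target a); lia.
have v2 : (target a - r <= base_vertex a.+1 <= minn N (target a + r.+1))%N.
  rewrite /base_vertex; have [aN1|aN1] := ltnP a.+1 N.
    have -> : minn a.+1 N.-1 = a.+1 by lia.
    have /andP := @pi_jump (Ordinal aN) (Ordinal aN1) erefl.
    rewrite -!targetE/= => -[]; have := target_lt aN1.
    have := odd_double_half (target a.+1); lia.
  have -> : minn a.+1 N.-1 = a by lia.
  by have := odd_double_half (target a); lia.
apply: walk_exists => //.
- by lia.
- by rewrite /base_vertex odd_double.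
- by rewrite /base_vertex odd_double.
- apply: leq_trans m_large; rewrite leq_mul2r/= leq_mul2l/=; lia.
Qed.

End WalkExists.

Variables (U : nat -> nat -> nat).
Hypothesis U_window : forall a, (a < N)%N -> window a (U a).

Lemma window_edge a i : (a < N)%N -> (i < m)%N ->
  near_cells r (target a) (edge (U a) i) && (edge (U a) i < N)%N.
Proof.
by move=> aN im; have := walk_edge (U_window aN) im; rewrite /near_cells; lia.
Qed.

Lemma window_bound a i : (a < N)%N -> (i <= m)%N -> (U a i <= N)%N.
Proof.
move=> aN im; have /andP[_ /leq_trans] := walk_range (U_window aN) im.
by apply; exact: geq_minl.
Qed.

Lemma window_count a k : (a < N)%N -> (k < N)%N -> near_cells r (target a) k ->
  (C <= edge_count m (U a) k)%N.
Proof.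
move=> aN kN /andP[h1 h2]; apply: (walk_count (U_window aN)); lia.
Qed.

End Windows.

Section Weights.
Variables (R : realType) (N r C m : nat) (pi : 'I_N -> 'I_N).
Variables (U : nat -> nat -> nat).
Hypotheses (N0 : (0 < N)%N) (C2 : (2 <= C)%N) (pi_inj : injective pi).
Hypothesis U_window : forall a, (a < N)%N -> window r C m pi a (U a).
Local Notation target := (target pi).

Lemma sum_target (V : nmodType) (G : nat -> V) :
  \sum_(a < N) G (target a) = \sum_(k < N) G k.
Proof.
by rewrite [RHS](reindex_inj pi_inj)/=; apply: eq_bigr => a _; rewrite targetE.
Qed.

(** The row [target a] of the band matrix, each entry being shared equally among the laps
    that cover the corresponding cell. *)
Definition spread a i : R :=
  band R N r (target a) (edge (U a) i) / (edge_count m (U a) (edge (U a) i))%:R.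

Lemma spread_gt0 a i : (a < N)%N -> (i < m)%N -> 0 < spread a i.
Proof.
move=> aN im; have /andP[nE eN] := window_edge U_window aN im.
rewrite /spread divr_gt0 ?band_gt0// ltr0n.
by apply: leq_trans (window_count U_window aN eN nE); exact: ltnW.
Qed.

Lemma spread_le a i : (a < N)%N -> (i < m)%N -> spread a i <= C%:R^-1.
Proof.
move=> aN im; have /andP[nE eN] := window_edge U_window aN im.
have cC := window_count U_window aN eN nE.
have C0 : 0 < C%:R :> R by rewrite ltr0n ltnW.
have n0 : 0 < (edge_count m (U a) (edge (U a) i))%:R :> R.
  by rewrite ltr0n (leq_trans (ltnW C2)).
rewrite /spread ler_pdivrMr// mulrC ler_pdivlMr//.
apply: (@le_trans _ _ (1 * C%:R)).
  by rewrite ler_pM2r// band_le1// target_lt.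
by rewrite mul1r ler_nat.
Qed.

Lemma spread_col a k : (a < N)%N -> (k < N)%N ->
  \sum_(i < m | edge (U a) i == k) spread a i = band R N r (target a) k.
Proof.
move=> aN kN.
rewrite (eq_bigr (fun=> band R N r (target a) k / (edge_count m (U a) k)%:R)); last first.
  by move=> i /eqP <-.
rewrite sumr_const -[LHS]mulr_natr -sum1_card big_mkcond/=.
have -> : (\sum_(i < m) (if edge (U a) i == k then 1 else 0) = edge_count m (U a) k)%N.
  by apply: eq_bigr => i _; case: eqP.
have [nk|/(band_far R N)->] := boolP (near_cells r (target a) k); last by rewrite !mul0r.
by rewrite mulfVK// pnatr_eq0 -lt0n (leq_trans _ (window_count U_window aN kN nk))// ltnW.
Qed.

Lemma spread_row a : (a < N)%N -> \sum_(i < m) spread a i = 1.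
Proof.
move=> aN; rewrite -(sum_band R r (target_lt pi aN)).
have eN (i : 'I_m) : (edge (U a) i < N)%N by have /andP[] := window_edge U_window aN (ltn_ord i).
rewrite (partition_big (fun i => Ordinal (eN i)) predT)//=.
by apply: eq_bigr => k _; rewrite -spread_col.
Qed.

(** The lap of cell [a] that gets all the length in the degenerate weights. *)
Lemma window_through_target : exists main_lap : nat -> nat, forall a, (a < N)%N ->
  (main_lap a < m)%N /\ edge (U a) (main_lap a) = target a.
Proof.
suff /choice[main_lap main_lapP] : forall a, exists d, (a < N)%N -> (d < m)%N /\ edge (U a) d = target a.
  by exists main_lap.
move=> a; have [aN|] := ltnP a N; last by exists 0%N.
have : (0 < edge_count m (U a) (target a))%N.
  apply: leq_trans (window_count U_window aN (target_lt pi aN) _); first exact: ltnW.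
  by rewrite /near_cells leq_addr.
rewrite lt0n sum_nat_eq0 negb_forall => /existsP[i /=].
by rewrite eqb0 negbK => /eqP iE; exists i.
Qed.

Variable main_lap : nat -> nat.
Hypothesis main_lap_lt : forall a, (a < N)%N -> (main_lap a < m)%N.
Hypothesis main_lap_edge : forall a, (a < N)%N -> edge (U a) (main_lap a) = target a.

Definition weight (s : R) (a i : nat) : R := (1 - s) * (i == main_lap a)%:R + s * spread a i.

Lemma weight_gt0 s a i : 0 < s <= 1 -> (a < N)%N -> (i < m)%N -> 0 < weight s a i.
Proof.
move=> /andP[s0 s1] aN im; apply: ltr_wpDl; first by rewrite mulr_ge0 ?subr_ge0.
by rewrite mulr_gt0 ?spread_gt0.
Qed.

Lemma C_inv_lt1 : C%:R^-1 < 1 :> R.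
Proof. by rewrite invf_lt1 ?ltr1n// ltr0n ltnW. Qed.

Lemma weight_lt1 s a i : 0 < s <= 1 -> (a < N)%N -> (i < m)%N -> weight s a i < 1.
Proof.
move=> /andP[s0 s1] aN im.
have h1 : s * spread a i < s * 1.
  by rewrite ltr_pM2l// (le_lt_trans (spread_le aN im) C_inv_lt1).
have h2 : (1 - s) * (i == main_lap a)%:R <= (1 - s) * 1.
  by rewrite ler_wpM2l ?subr_ge0// lern1 leq_b1.
rewrite /weight; lra.
Qed.

Lemma weight_row s a : (a < N)%N -> \sum_(i < m) weight s a i = 1.
Proof.
move=> aN; rewrite big_split/= -!mulr_sumr spread_row// mulr1.
rewrite (bigD1 (Ordinal (main_lap_lt aN)))//= eqxx big1 ?addr0 ?mulr1 ?subrK//.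
by move=> i; rewrite -(inj_eq val_inj)/= => /negbTE->.
Qed.

(** [pi] is a permutation and the columns of the band matrix have sum 1. *)
Lemma weight_col s k : (k < N)%N ->
  \sum_(a < N) \sum_(i < m | edge (U a) i == k) weight s a i = 1.
Proof.
move=> kN.
rewrite (eq_bigr (fun a : 'I_N => (1 - s) * (target a == k)%:R + s * band R N r (target a) k)).
  rewrite big_split/= -!mulr_sumr.
  rewrite (sum_target (fun l => (l == k)%:R : R)) (sum_target (fun l => band R N r l k)).
  under [X in s * X]eq_bigr do rewrite band_sym.
  rewrite sum_band// mulr1 (bigD1 (Ordinal kN))//= eqxx big1 ?addr0 ?mulr1 ?subrK//.
  by move=> l; rewrite -(inj_eq val_inj)/= => /negbTE->.
move=> a _; have aN := ltn_ord a; rewrite big_split/= -!mulr_sumr spread_col//.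
congr (_ * _ + _); rewrite -(main_lap_edge aN) big_mkcond/=.
rewrite (bigD1 (Ordinal (main_lap_lt aN)))//= eqxx big1 ?addr0; first by case: eqP.
by move=> i; rewrite -(inj_eq val_inj)/= => /negbTE->; case: ifP.
Qed.

(** For [s = 1] all weights are at most [1/C], so the entropy is at least [ln C]. *)
Lemma weight_entropy_value c : 0 < c -> c <= ln C%:R ->
  exists2 s, 0 < s <= 1 &
    N%:R^-1 * \sum_(a < N) \sum_(i < m) weight s a i * - ln (weight s a i) = c.
Proof.
move=> c0 cC; have N0R : 0 < N%:R :> R by rewrite ltr0n.
have C0 : 0 < C%:R :> R by rewrite ltr0n ltnW.
pose w (p : 'I_N * 'I_m) : R := spread p.1 p.2.
pose b (p : 'I_N * 'I_m) : bool := val p.2 == main_lap p.1.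
have w_gt0 p : 0 < w p by exact: spread_gt0.
have w_le p : w p <= C%:R^-1 by exact: spread_le.
have w_le1 p : w p <= 1 by rewrite (le_trans (w_le p))// ltW// C_inv_lt1.
have [||s s01 sE] := @mix_entropy_value R _ b w w_gt0 w_le1 (N%:R * c).
- by rewrite mulr_gt0.
- rewrite /mix_entropy; apply: (@le_trans _ _ (\sum_p w p * ln C%:R)).
    rewrite -mulr_suml -(pair_bigA _ (fun (a : 'I_N) (i : 'I_m) => spread a i))/=.
    rewrite (eq_bigr (fun=> 1)); last by move=> a _; rewrite spread_row.
    by rewrite sumr_const card_ord ler_wpM2l.
  apply: ler_sum => p _; rewrite /mix subrr mul0r add0r mul1r ler_pM2l//.
  by rewrite lerNr -lnV ?posrE// ler_ln ?posrE ?invr_gt0.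
exists s => //; rewrite pair_bigA/= -[RHS](mulKf (_ : N%:R != 0)) ?gt_eqF//.
by rewrite -sE.
Qed.
End Weights.

(** * Density *)

(** With [w] the oscillation of [f] on the cells, consecutive values of [pi] differ by at
    most [3 w N], so windows of radius [r] slightly larger than that can be linked.  The
    zigzag map stays within [r + 1] cells of [pi a] on cell [a]. *)
Lemma approximant_exists (R : realType) (f : R -> R) (c e : R) :
  C_lambda f -> 0 < c -> 0 < e ->
  exists2 g, PAM_lambda_entr c g & forall x, unit_itv x -> `|f x - g x| <= e.
Proof.
move=> Cf c0 e0; have [fD cf mpf] := Cf.
pose w := e / 10; have w0 : 0 < w by rewrite divr_gt0.
have [q q0 qf] := uniformly_continuous_unit_itv cf w0.
pose N := Num.bound (q^-1 + 4 / e).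
have qe0 : 0 <= q^-1 + 4 / e by rewrite addr_ge0 ?invr_ge0 ?divr_ge0 ?ltW.
have NE : q^-1 + 4 / e < N%:R by exact: archi_boundP.
have N0R : 0 < N%:R :> R by rewrite (le_lt_trans qe0).
have N0 : (0 < N)%N by rewrite -(ltr0n R).
have Nq : N%:R^-1 <= q.
  rewrite -[q]invrK lef_pV2 ?posrE ?invr_gt0// ltW// (le_lt_trans _ NE)//.
  by rewrite lerDl divr_ge0 ?ltW.
have Ne : 2 / N%:R <= e / 2.
  rewrite ler_pdivrMr//.
  have : 4 / e < N%:R by rewrite (le_lt_trans _ NE)// lerDr invr_ge0 ltW.
  by rewrite ltr_pdivrMr//; lra.
have fw x y : unit_itv x -> unit_itv y -> `|x - y| <= N%:R^-1 -> `|f x - f y| <= w.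
  by move=> Dx Dy xy; apply: qf => //; exact: le_trans Nq.
have [pi [pi_inj piE]] := rank_permutation N0 Cf fw.
have w3 : 0 <= 3 * w * N%:R by rewrite !mulr_ge0// ltW.
pose r := (Num.truncn (3 * w * N%:R)).+1.
have /andP[r1 r2] : (Num.truncn (3 * w * N%:R))%:R <= 3 * w * N%:R < r%:R.
  exact: truncn_itv.
have jump (a b : 'I_N) : b = a.+1 :> nat -> (pi b < pi a + r)%N && (pi a < pi b + r)%N.
  move=> ba.
  have h : `|f (a%:R / N%:R) - f (b%:R / N%:R)| <= w.
    apply: fw; [exact/grid_unit_itv/ltnW|exact/grid_unit_itv/ltnW|].
    by rewrite -mulrBl ba -natr1 opprD addNKr mulN1r normrN ger0_norm ?invr_ge0.
  have := piE a; have := piE b.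
  rewrite !ler_norml => /andP[b1 b2] /andP[a1 a2].
  move: h; rewrite ler_norml => /andP[h1 h2].
  have piN (d : 'I_N) : (pi d)%:R = (pi d)%:R / N%:R * N%:R :> R.
    by rewrite mulfVK// gt_eqF.
  rewrite -!(ltr_nat R) !natrD.
  have X1 : ((pi b)%:R / N%:R - (pi a)%:R / N%:R) * N%:R <= 3 * w * N%:R.
    by rewrite ler_pM2r//; lra.
  have X2 : ((pi a)%:R / N%:R - (pi b)%:R / N%:R) * N%:R <= 3 * w * N%:R.
    by rewrite ler_pM2r//; lra.
  rewrite mulrBl -!piN in X1; rewrite mulrBl -!piN in X2.
  by apply/andP; split; lra.
pose C := (Num.bound (expR c)).+2.
have C2 : (2 <= C)%N by [].
have cC : c <= ln C%:R.
  rewrite -[c]expRK ler_ln ?posrE ?expR_gt0//.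
  apply: ltW; apply: lt_le_trans (archi_boundP (expR_ge0 c)) _.
  by rewrite ler_nat /C leqW.
pose m := (C.+1 * r.*2.+1 * 2)%N.
have m_even : ~~ odd m by rewrite /m muln2 odd_double.
have m0 : (0 < m)%N by rewrite /m !muln_gt0.
have /choice[U UP] : forall a, exists U : nat -> nat,
    ((a < N)%N -> window r C m pi a U) /\ U 0%N = base_vertex pi a.
  move=> a; have [aN|_] := ltnP a N; last by exists (fun=> base_vertex pi a).
  have [U wU] := window_walk_exists (C := C) (isT : (0 < r)%N) jump m_even (leqnn m) aN.
  by exists U; split=> //; exact: walk_start wU.
have wU a : (a < N)%N -> window r C m pi a (U a) by move=> aN; have [+ _] := UP a; exact.
have U0 a : U a 0%N = base_vertex pi a by have [] := UP a.
have [main_lap main_lapP] := window_through_target C2 wU.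
have main_lap_lt a : (a < N)%N -> (main_lap a < m)%N by move=> /main_lapP[].
have main_lap_edge a : (a < N)%N -> edge (U a) (main_lap a) = target pi a by move=> /main_lapP[].
have [s s01 sE] := weight_entropy_value N0 C2 wU main_lap c0 cC.
pose W := weight r m pi U main_lap s.
have U_match a : (a < N)%N -> U a m = U a.+1 0%N.
  by move=> aN; rewrite U0; exact: walk_end (wU a aN).
have U_adj a i : (a < N)%N -> (i < m)%N -> U a i.+1 = (U a i).+1 \/ U a i = (U a i.+1).+1.
  by move=> aN; exact: walk_adj (wU a aN) i.
have U_bound a i : (a < N)%N -> (i <= m)%N -> (U a i <= N)%N.
  exact: (window_bound wU).
have Wg a i : (a < N)%N -> (i < m)%N -> 0 < W a i by exact: (weight_gt0 N0 C2 wU).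
have Wl a i : (a < N)%N -> (i < m)%N -> W a i < 1 by exact: (weight_lt1 N0 C2 wU).
have Wr a : (a < N)%N -> \sum_(i < m) W a i = 1 by exact: (weight_row C2 wU).
have Wc k : (k < N)%N -> \sum_(a < N) \sum_(i < m | edge (U a) i == k) W a i = 1.
  exact: (weight_col C2 pi_inj wU).
have Z := glue_zigzag N0 m0 U_match U_adj U_bound Wg Wl Wr Wc.
exists (zigzag N (N * m) (glue_ell N m W) (glue_u m U)).
  split; first exact: zigzag_PAM N0 Z.
  by rewrite /= (zigzag_entropy N0 Z) glue_entropy// sE.
move=> x Dx.
have [a [i [aN im xa gx]]] := glue_range N0 m0 U_match U_adj U_bound Wg Wl Wr Wc Dx.
have /andP[/andP[n1 n2] _] := window_edge wU aN im.
have fx : `|f x - f (a%:R / N%:R)| <= w.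
  apply: fw => //; first exact/grid_unit_itv/ltnW.
  move: xa => /andP[x1 x2]; rewrite ger0_norm ?subr_ge0// lerBlDl (le_trans x2)//.
  by rewrite -natr1 mulrDl mul1r.
have := piE (Ordinal aN); rewrite -targetE/= => pa.
have E1 : (target pi a)%:R / N%:R <= (edge (U a) i)%:R / N%:R + r%:R / N%:R :> R.
  by rewrite -mulrDl -natrD ler_pM2r ?invr_gt0// ler_nat.
have E2 : (edge (U a) i)%:R / N%:R <= (target pi a)%:R / N%:R + r%:R / N%:R :> R.
  by rewrite -mulrDl -natrD ler_pM2r ?invr_gt0// ler_nat.
have E3 : r%:R / N%:R <= 3 * w + 1 / N%:R.
  rewrite ler_pdivrMr// mulrDl divfK ?gt_eqF// /r -natr1; lra.
move: gx; rewrite -natr1 mulrDl => /andP[g1 g2].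
move: fx pa; rewrite !ler_norml => /andP[f1 f2] /andP[p1 p2].
have wE : e = 10 * w by rewrite /w; field.
have N1 : 1 / N%:R <= e / 4 by move: Ne; lra.
by apply/andP; split; lra.
Qed.

Theorem proposition24 (R : realType) (c : R) (hc : (0 < c)%R) :
  dense_in (@rho R) (@C_lambda R) (PAM_lambda_entr c).
Proof.
split; first by move=> g [[[]]].
move=> f Cf e e0; have [|g gP fg] := approximant_exists Cf hc (e := e / 2).
  by rewrite divr_gt0.
exists g => //; apply: (@le_lt_trans _ _ (e / 2)); last by lra.
apply: ge_sup.
  by exists `|f 0 - g 0|, 0 => //; rewrite /unit_itv/= in_itv/= lexx ler01.
by move=> _ [x Dx <-]; exact: fg.
Qed.
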